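(* For every $f\in\mathrm{LC}_{\mathrm c}(\mathbb{R}^n)$ we have $$J(f)\le J(f_{\mathrm{rot}}).$$
   Context: $\mathrm{Conv}_{\mathrm c}(\mathbb{R}^n)$ is the set of convex functions $\psi\colon\mathbb{R}^n\to(-\infty,\infty]$ that are proper ($\psi\not\equiv\infty$), lower semicontinuous, and coercive ($\lim_{|x|\to\infty}\psi(x)=\infty$). $\mathrm{LC}_{\mathrm c}(\mathbb{R}^n)=\{f=e^{-\psi}:\psi\in\mathrm{Conv}_{\mathrm c}(\mathbb{R}^n)\}$ (with $e^{-\infty}=0$). Here $n\geq 1$. Total mass: $J(f)=\int_{\mathbb{R}^n}f(x)\,\mathrm{d}x$. Legendre--Fenchel transform: $\mathcal{L}\psi(x)=\sup_{y\in\mathbb{R}^n}(\langle x,y\rangle-\psi(y))$. Rotational epi-symmetrization: for $n\ge2$ and $\psi\in\mathrm{Conv}_{\mathrm c}(\mathbb{R}^n)$, $\psi_{\mathrm{rot}}$ is the unique function in $\mathrm{Conv}_{\mathrm c}(\mathbb{R}^n)$ with $\mathcal{L}\psi_{\mathrm{rot}}(x)=\int_{\mathrm{SO}(n)}\mathcal{L}\psi(\vartheta^{-1}x)\,\mathrm{d}\vartheta$ for all $x$ (Haar probability measure on $\mathrm{SO}(n)$). For $n=1$, $\psi_{\mathrm{rot}}(x)=\tfrac12\,(\psi\,\square\,\psi^-)(2x)$, where $\psi^-(x)=\psi(-x)$ and $(\psi_1\,\square\,\psi_2)(x)=\inf_{y}(\psi_1(x-y)+\psi_2(y))$. Rotational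 hypo-symmetrization of $f=e^{-\psi}\in\mathrm{LC}_{\mathrm c}(\mathbb{R}^n)$: $f_{\mathrm{rot}}=e^{-\psi_{\mathrm{rot}}}$. *)

(* Defs.v *)
From HB Require Import structures.
From mathcomp Require Import all_boot all_order all_algebra.
From mathcomp Require Import all_classical all_reals all_analysis.
Import Order.TTheory GRing.Theory Num.Theory.
Import numFieldNormedType.Exports.

Set Implicit Arguments.
Unset Strict Implicit.
Unset Printing Implicit Defensive.

Local Open Scope classical_set_scope.
Local Open Scope ring_scope.
Local Open Scope ereal_scope.

(* Points of R^n are column vectors, on which matrices act from the left. *)

Definition dotp (R : realType) (n : nat) (x y : 'cV[R]_n) : R :=
  (\sum_(i < n) x i ord0 * y i ord0)%R.

(* The library norm on matrices is the sup norm, hence this definition. *)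
Definition enorm (R : realType) (n : nat) (x : 'cV[R]_n) : R :=
  Num.sqrt (dotp x x).

Definition convex_efun (R : realType) (n : nat) (psi : 'cV[R]_n -> \bar R) :=
  forall (x y : 'cV[R]_n) (t : R), (0 < t < 1)%R ->
    psi (t *: x + (1 - t) *: y)%R <= t%:E * psi x + (1 - t)%:E * psi y.

Definition coercive (R : realType) (n : nat) (psi : 'cV[R]_n -> \bar R) :=
  forall M : R, exists r : R, forall x, (r < enorm x)%R -> M%:E < psi x.

Definition Conv_c (R : realType) (n : nat) : set ('cV[R]_n -> \bar R) :=
  [set psi | [/\ forall x, -oo < psi x,
                 convex_efun psi,
                 exists x, psi x != +oo,
                 lower_semicontinuous psi &
                 coercive psi]].

(* [expeR (- +oo) = 0]; [fine] loses nothing when [psi] avoids [-oo]. *)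
Definition expN (R : realType) (n : nat) (psi : 'cV[R]_n -> \bar R) :
    'cV[R]_n -> R :=
  fun x => fine (expeR (- psi x)).

Definition LC_c (R : realType) (n : nat) : set ('cV[R]_n -> R) :=
  [set expN psi | psi in @Conv_c R n].

(* Lebesgue measure on R^n, as an n-fold product carried by [n.-tuple R],
   the library's measurable type for finite powers. *)
Definition tcons (R : realType) (n : nat) (p : n.-tuple R * R) :
    n.+1.-tuple R :=
  [the n.+1.-tuple R of p.2 :: p.1].

Lemma measurable_tcons (R : realType) (n : nat) :
  measurable_fun [set: n.-tuple R * R] (@tcons R n).
Proof. exact: measurable_cons. Qed.

Definition lebesgue_step (R : realType) (n : nat)
    (m : {measure set (n.-tuple R) -> \bar R}) :=
  pushforward (m \x lebesgue_measure) (@tcons R n).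

Section lebesgue_step_measure.
Context (R : realType) (n : nat) (m : {measure set (n.-tuple R) -> \bar R}).

Let step0 : lebesgue_step m set0 = 0.
Proof. by rewrite /lebesgue_step /pushforward preimage_set0 measure0. Qed.

Let step_ge0 A : 0 <= lebesgue_step m A.
Proof. by apply: measure_ge0; exact: measurable_tcons. Qed.

Let step_sigma_additive : semi_sigma_additive (lebesgue_step m).
Proof.
by apply: measure_semi_sigma_additive; exact: measurable_tcons.
Qed.

HB.instance Definition _ := isMeasure.Build _ _ _ (lebesgue_step m)
  step0 step_ge0 step_sigma_additive.

End lebesgue_step_measure.

Fixpoint lebesgue_n (R : realType) (n : nat) :
    {measure set (n.-tuple R) -> \bar R} :=
  match n with
  | 0 => dirac [tuple]
  | m.+1 => lebesgue_step (lebesgue_n R m)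
  end.

Definition col_of_tuple (R : realType) (n : nat) (t : n.-tuple R) : 'cV[R]_n :=
  (\col_i tnth t i)%R.

Definition J (R : realType) (n : nat) (f : 'cV[R]_n -> R) : \bar R :=
  \int[lebesgue_n R n]_t (f (col_of_tuple t))%:E.

Definition Legendre (R : realType) (n : nat) (psi : 'cV[R]_n -> \bar R)
    (x : 'cV[R]_n) : \bar R :=
  ereal_sup [set (dotp x y)%:E - psi y | y in [set: 'cV[R]_n]].

Definition infconv (R : realType) (n : nat) (psi1 psi2 : 'cV[R]_n -> \bar R)
    (x : 'cV[R]_n) : \bar R :=
  ereal_inf [set psi1 (x - y)%R + psi2 y | y in [set: 'cV[R]_n]].

Definition SO (R : realType) (n : nat) : set 'M[R]_n :=
  [set A | (A *m A^T = 1%:M)%R /\ (\det A = 1)%R].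

Definition mxborel (R : realType) (n : nat) :=
  g_sigma_algebraType (@open 'M[R]_n).

(* The Haar probability measure of SO(n), seen as a Borel measure on the space
   of matrices which is carried by SO(n). *)
Definition is_haar_SO (R : realType) (n : nat)
    (mu : probability (mxborel R n) R) :=
  mu (@SO R n) = 1 /\
  forall (A : 'M[R]_n) (B : set (mxborel R n)), SO A -> measurable B ->
    mu [set C : 'M[R]_n | B (A *m C)%R] = mu B.

Definition is_epi_rot (R : realType) (n : nat)
    (mu : probability (mxborel R n) R) (psi phi : 'cV[R]_n -> \bar R) :=
  if n == 1%N then
    forall x, phi x = (2^-1)%:E * infconv psi (fun y => psi (- y)%R) (2 *: x)%R
  else
    Conv_c phi /\
    forall x, Legendre phi x =
      \int[mu]_(A in @SO R n) Legendre psi (invmx (A : 'M[R]_n) *m x)%R.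

Definition is_hypo_rot (R : realType) (n : nat)
    (mu : probability (mxborel R n) R) (f g : 'cV[R]_n -> R) :=
  exists psi phi : 'cV[R]_n -> \bar R,
    [/\ Conv_c psi, f = expN psi, is_epi_rot mu psi phi & g = expN phi].

(* Main.v *)
Require Import Defs.
From HB Require Import structures.
From mathcomp Require Import all_boot all_order all_algebra.
From mathcomp Require Import all_classical all_reals all_analysis.
From mathcomp Require Import measurable_realfun ring lra.
Import Order.TTheory GRing.Theory Num.Theory.
Import numFieldNormedType.Exports.

(** Write [f = exp (- psi)] and [f_rot = exp (- phi)]. The function [phi] is the
    mean, in the sense of infimal convolution, of the rotated copies
    [psi o A ^-1] of [psi]: if [z] assigns to each rotation [A] a point [z_A],
    then [phi] at the mean of the [A z_A] is at most the mean of the [psi z_A].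
    For n >= 2 this follows from biduality. By definition the Legendre transform
    of [phi] at [x] is the mean of the values [Legendre psi (A ^-1 x)], and each
    of these is at least [<x, A z_A> - psi z_A]; now every value of [phi] is a
    supremum of affine minorants ([affine_minorant]). For n = 1 it is the
    definition of [phi].

    The Prekopa-Leindler inequality turns such an inequality into one for
    integrals: the integral of [exp (- phi)] is at least the geometric mean of
    the integrals of the functions [exp (- psi o A ^-1)]. These are all equal to
    the integral of [exp (- psi)], because rotations preserve Lebesgue measure
    ([scales_lebn_unit]).

    The Prekopa-Leindler inequality is proved for finitely many functions
    ([prekopa_leindler]), by induction on the dimension from a one-dimensional
    Brunn-Minkowski inequality ([brunn_minkowski1]). So the integral over SO(n)
    has to be discretised. Restrict [psi] to a cube and cut SO(n) into finitely
    many cells of small diameter, with one chosen rotation in each. If [z_A]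
    depends only on the cell of [A], the mean of the [A z_A] differs from the
    corresponding finite mean, over the chosen rotations, by an arbitrarily small
    displacement ([SO_below_averages]). Consequently the finite Prekopa-Leindler
    inequality holds with [exp (- phi)] replaced by its supremum over small
    cubes. As the cubes shrink, the integral of this supremum tends to the
    integral of [exp (- phi)], since [phi] is lower semicontinuous and all
    functions are dominated by a multiple of the indicator of a cube. Finally the
    cube to which [psi] was restricted is enlarged ([J_le_of_averages]). *)

Set Implicit Arguments.
Unset Strict Implicit.
Unset Printing Implicit Defensive.

Local Open Scope classical_set_scope.
Local Open Scope ring_scope.
Local Open Scope ereal_scope.

(** * Affine changes of variable on the line *)

Lemma measurable_affine (R : realType) (c b : R) :
  measurable_fun [set: R] (fun x => c * x + b)%R.
Proof. by apply: measurable_realfun.measurable_funD. Qed.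

(** When [c != 0], Lebesgue measure is [`|c|] times this measure, because the two
    agree on intervals; that is the affine change of variable. *)
Definition affine_image (R : realType) (c b : R)
    : set (measurableTypeR R) -> \bar R :=
  pushforward (@lebesgue_measure R) (fun x : measurableTypeR R => c * x + b)%R.

Section affine.
Context (R : realType) (c b : R).

Let affine_image0 : affine_image c b set0 = 0.
Proof. by rewrite /affine_image /pushforward preimage_set0 measure0. Qed.

Let mphi : measurable_fun [set: measurableTypeR R]
  (fun x : measurableTypeR R => c * x + b : measurableTypeR R)%R.
Proof. exact: measurable_affine. Qed.

Let pushforward_measure :=
  measure_function_pushforward__canonical__measure_function_Measure
    (@lebesgue_measure R) mphi.

Let affine_image_ge0 A : 0 <= affine_image c b A.
Proof. exact: (@measure_ge0 _ _ _ pushforward_measure). Qed.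

Let affine_image_sigma_additive : semi_sigma_additive (affine_image c b).
Proof.
exact: (@measure_semi_sigma_additive _ _ _ pushforward_measure).
Qed.

HB.instance Definition _ := isMeasure.Build _ _ _ (affine_image c b)
  affine_image0 affine_image_ge0 affine_image_sigma_additive.

Hypothesis c0 : c != 0%R.
Let nu := mscale (NngNum (normr_ge0 c)) (affine_image c b).

Lemma lebesgue_measure_affine (A : set R) : measurable A ->
  lebesgue_measure A = nu A.
Proof.
apply: lebesgue_measure_unique => X [[x y] /= _ <-].
rewrite /nu /mscale /= /affine_image /pushforward.
have [xy|xy] := leP y x.
  rewrite set_itv_ge ?bnd_simp -?leNgt// preimage_set0.
  by rewrite !measure0 mule0.
have [cp|cn|cE] := ltgtP 0%R c; last by move: c0; rewrite -cE eqxx.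
- rewrite (_ : _ @^-1` _ =
      `]((x - b) / c)%R, ((y - b) / c)%R]%classic); last first.
    apply/seteqP; split => z /=; rewrite !in_itv/=.
      by rewrite ltr_pdivrMr// ler_pdivlMr//; lra.
    by rewrite ltr_pdivrMr// ler_pdivlMr//; lra.
  rewrite !lebesgue_measure_itv/= !lte_fin xy ltr_pM2r ?invr_gt0// ltrD2r xy.
  rewrite gtr0_norm// -!EFinB -EFinM; congr EFin.
  by field.
- rewrite (_ : _ @^-1` _ =
      `[((y - b) / c)%R, ((x - b) / c)%R[%classic); last first.
    apply/seteqP; split => z /=; rewrite !in_itv/=.
      by rewrite ltr_ndivlMr// ler_ndivrMr//; lra.
    by rewrite ltr_ndivlMr// ler_ndivrMr//; lra.
  rewrite !lebesgue_measure_itv/= !lte_fin xy ltr_nM2r ?invr_lt0// ltrD2r xy.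
  rewrite ltr0_norm// -!EFinB -EFinM; congr EFin.
  by field; rewrite lt_eqF.
Qed.

Lemma ge0_integral_affine (f : R -> \bar R) :
  measurable_fun [set: R] f -> (forall x, 0 <= f x) ->
  `|c|%:E * \int[lebesgue_measure]_x f (c * x + b)%R =
  \int[lebesgue_measure]_x f x.
Proof.
move=> mf f0.
rewrite [RHS](eq_measure_integral nu); last first.
  by move=> A mA _; exact: lebesgue_measure_affine.
rewrite ge0_integral_mscale//; congr (_ * _).
rewrite ge0_integral_pushforward//; exact: measurable_affine.
Qed.
End affine.

(** * Lebesgue measure on n-tuples *)

Lemma ge0_integral_lebesgue_step (R : realType) (n : nat)
    (m : {measure set (n.-tuple R) -> \bar R}) (f : n.+1.-tuple R -> \bar R) :
  measurable_fun [set: n.+1.-tuple R] f -> (forall t, 0 <= f t) ->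
  \int[lebesgue_step m]_t f t =
  \int[m \x lebesgue_measure]_p f (tcons p).
Proof.
move=> mf f0; rewrite ge0_integral_pushforward//; exact: measurable_tcons.
Qed.

Definition cube (R : realType) (n : nat) (M : R) : set (n.-tuple R) :=
  [set t | forall i, `|tnth t i| <= M]%R.
Arguments cube {R} n M.

Lemma measurable_cube (R : realType) (n : nat) (M : R) :
  measurable (cube n M).
Proof.
rewrite (_ : cube n M =
    \bigcap_(i in [set: 'I_n]) [set t | `|tnth t i| <= M]%R); last first.
  by apply/seteqP; split => [t h i _|t h i]; [exact: h|exact: (h i)].
apply: fin_bigcap_measurable => // i _.
have h : measurable_fun [set: n.-tuple R] (fun t => `|tnth t i|%R).
  by apply: measurableT_comp => //; exact: measurable_tnth.
have := h measurableT `]-oo, M]%classic (measurable_itv _).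
rewrite setTI; congr (measurable _); apply/seteqP; split => t /=;
  by rewrite in_itv.
Qed.

Lemma cubeS (R : realType) (n : nat) (M : R) :
  @tcons R n @^-1` cube n.+1 M = cube n M `*` `[(- M)%R, M].
Proof.
apply/seteqP; split => [[p s]|[p s] [/= hp hs] i].
  move=> h; split => /=.
    by move=> i; have := h (lift ord0 i); rewrite tnthS.
  by have := h ord0; rewrite in_itv/= ler_norml.
case: (unliftP ord0 i) => [j ->|->]; first by rewrite tnthS; exact: hp.
by rewrite tnth0/= ler_norml; rewrite in_itv/= in hs.
Qed.

(** Cubes have finite measure and exhaust the space, whence sigma-finiteness. *)
Lemma lebesgue_n_cube (R : realType) (n : nat) (M : R) :
  lebesgue_n R n (cube n M) < +oo.
Proof.
elim: n => [|n IH] /=.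
  by rewrite diracE; case: (_ \in _); rewrite ltry.
rewrite /lebesgue_step /pushforward cubeS.
rewrite [ltLHS]product_measure1E//; last exact: measurable_cube.
rewrite lte_mul_pinfty// ?ge0_fin_numE//.
rewrite [ltLHS](lebesgue_measure_itv `[(- M)%R, M])/=.
by case: ifP => _; rewrite ltry.
Qed.

Lemma sigma_finite_lebesgue_n (R : realType) (n : nat) :
  sigma_finite setT (lebesgue_n R n).
Proof.
exists (fun k => cube n k%:R); last first.
  by move=> k; split; [exact: measurable_cube|exact: lebesgue_n_cube].
apply/seteqP; split => // t _ /=.
exists (\sum_(i < n) (Num.truncn (`|tnth t i|%R : R)).+1)%N => // i.
rewrite (le_trans (ltW (truncnS_gt _)))// ler_nat (bigD1 i)//=.
exact: leq_addr.
Qed.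

(** The same measure under a name that carries its sigma-finiteness, which
    Tonelli's theorem asks for. *)
Definition lebn (R : realType) (n : nat) : set (n.-tuple R) -> \bar R :=
  lebesgue_n R n.
Arguments lebn R n : clear implicits.

HB.instance Definition _ (R : realType) (n : nat) :=
  Measure.on (lebn R n).
HB.instance Definition _ (R : realType) (n : nat) :=
  Measure_isSigmaFinite.Build _ _ _ (lebn R n) (sigma_finite_lebesgue_n R n).

Section tonelli.
Context (R : realType) (n : nat) (f : n.+1.-tuple R -> \bar R).
Hypothesis mf : measurable_fun [set: n.+1.-tuple R] f.
Hypothesis f0 : forall t, 0 <= f t.

Let mf' : measurable_fun [set: n.-tuple R * R] (f \o @tcons R n).
Proof. by apply: measurableT_comp => //; exact: measurable_tcons. Qed.

Lemma lebnS : \int[lebn R n.+1]_t f t =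
  \int[lebesgue_measure]_s \int[lebn R n]_p f (tcons (p, s)).
Proof.
transitivity (\int[lebn R n \x lebesgue_measure]_p (f \o @tcons R n) p).
  exact: (@ge0_integral_lebesgue_step _ _ (lebn R n)).
apply: (@fubini_tonelli2 _ _ _ _ _ (lebn R n) lebesgue_measure _ mf').
by move=> p; exact: f0.
Qed.

Lemma lebnS_swap : \int[lebn R n.+1]_t f t =
  \int[lebn R n]_p \int[lebesgue_measure]_s f (tcons (p, s)).
Proof.
transitivity (\int[lebn R n \x lebesgue_measure]_p (f \o @tcons R n) p).
  exact: (@ge0_integral_lebesgue_step _ _ (lebn R n)).
apply: (@fubini_tonelli1 _ _ _ _ _ (lebn R n) lebesgue_measure _ mf').
by move=> p; exact: f0.
Qed.

Lemma measurable_lebn_section : measurable_fun [set: R]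
  (fun s => \int[lebn R n]_p f (tcons (p, s))).
Proof.
apply: (@measurable_fun_fubini_tonelli_G _ _ _ _ _ (lebn R n) _ mf').
by move=> p; exact: f0.
Qed.

Lemma measurable_section1 (s : R) :
  measurable_fun [set: n.-tuple R] (fun p => f (tcons (p, s))).
Proof.
apply: (@measurableT_comp _ _ _ _ _ _ (f \o @tcons R n)) => //.
Qed.

Lemma measurable_section2 (p : n.-tuple R) :
  measurable_fun [set: R] (fun s => f (tcons (p, s))).
Proof.
apply: (@measurableT_comp _ _ _ _ _ _ (f \o @tcons R n)) => //.
Qed.

End tonelli.

(** * Linear changes of variable *)

Definition tuple_of_col (R : realType) (n : nat) (x : 'cV[R]_n) : n.-tuple R :=
  [tuple x i ord0 | i < n].

Lemma col_of_tupleK (R : realType) (n : nat) :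
  cancel (@col_of_tuple R n) (@tuple_of_col R n).
Proof. by move=> t; apply: eq_from_tnth => i; rewrite tnth_mktuple mxE. Qed.

Lemma tuple_of_colK (R : realType) (n : nat) :
  cancel (@tuple_of_col R n) (@col_of_tuple R n).
Proof.
by move=> x; apply/matrixP => i j; rewrite mxE tnth_mktuple (ord1 j).
Qed.

Definition tmul (R : realType) (n : nat) (M : 'M[R]_n) (t : n.-tuple R) :
  n.-tuple R := tuple_of_col (M *m col_of_tuple t)%R.

Lemma tnth_tmul (R : realType) (n : nat) (M : 'M[R]_n) (t : n.-tuple R) i :
  tnth (tmul M t) i = (\sum_(j < n) M i j * tnth t j)%R.
Proof.
by rewrite tnth_mktuple mxE; apply: eq_bigr => j _; rewrite mxE.
Qed.

Lemma measurable_tmul (R : realType) (n : nat) (M : 'M[R]_n) :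
  measurable_fun [set: n.-tuple R] (tmul M).
Proof.
apply/measurable_fun_tnthP => i /=.
rewrite (_ : _ \o _ = fun t => (\sum_(j < n) M i j * tnth t j)%R); last first.
  by apply/funext => t /=; rewrite tnth_tmul.
apply: measurable_sum => j; apply: measurable_funM => //.
exact: measurable_tnth.
Qed.

Lemma tmulM (R : realType) (n : nat) (A B : 'M[R]_n) (t : n.-tuple R) :
  tmul (A *m B)%R t = tmul A (tmul B t).
Proof. by rewrite /tmul tuple_of_colK mulmxA. Qed.

Definition tadd (R : realType) (n : nat) (v t : n.-tuple R) : n.-tuple R :=
  [tuple (tnth v i + tnth t i)%R | i < n].

Lemma measurable_tadd (R : realType) (n : nat) (v : n.-tuple R) :
  measurable_fun [set: n.-tuple R] (tadd v).
Proof.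
apply/measurable_fun_tnthP => i /=.
rewrite (_ : _ \o _ = fun t => (tnth v i + tnth t i)%R); last first.
  by apply/funext => t /=; rewrite tnth_mktuple.
apply: measurable_funD => //; exact: measurable_tnth.
Qed.

Lemma tnth_tcons0 (R : realType) (n : nat) (p : n.-tuple R) (s : R) :
  tnth (tcons (p, s)) ord0 = s.
Proof. by rewrite tnth0. Qed.

Lemma tnth_tconsS (R : realType) (n : nat) (p : n.-tuple R) (s : R) (j : 'I_n) :
  tnth (tcons (p, s)) (lift ord0 j) = tnth p j.
Proof. by rewrite tnthS. Qed.

Lemma col_of_tcons (R : realType) (n : nat) (p : n.-tuple R) (s : R) :
  col_of_tuple (tcons (p, s)) =
  (col_mx s%:M (col_of_tuple p) : 'cV[R]_(1 + n))%R.
Proof.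
apply/matrixP => i j; rewrite (ord1 j) mxE.
case: (unliftP ord0 i) => [k ->|->].
  have -> : lift ord0 k = rshift 1 (k : 'I_n) :> 'I_(1 + n) by exact/val_inj.
  rewrite [RHS]col_mxEd mxE -[RHS](tnth_tconsS p s); congr tnth; exact/val_inj.
have -> : ord0 = lshift n (@ord0 0) :> 'I_(1 + n) by exact/val_inj.
rewrite [RHS]col_mxEu mxE eqxx mulr1n -[RHS](tnth_tcons0 p).
by congr tnth; exact/val_inj.
Qed.

Lemma tuple_of_col_mx (R : realType) (n : nat) (x : 'cV[R]_1) (y : 'cV[R]_n) :
  tuple_of_col (col_mx x y : 'cV[R]_(1 + n)) =
  tcons (tuple_of_col y, x ord0 ord0).
Proof.
apply: (can_inj (@col_of_tupleK R _)); rewrite col_of_tcons !tuple_of_colK.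
by rewrite -mx11_scalar.
Qed.

Lemma tmul_block (R : realType) (n : nat) (a : 'M[R]_1) (b : 'rV[R]_n)
    (c : 'cV[R]_n) (d : 'M[R]_n) (p : n.-tuple R) (s : R) :
  tmul (block_mx a b c d : 'M[R]_(1 + n)) (tcons (p, s)) =
  tcons (tadd (tuple_of_col (s *: c)%R) (tmul d p),
         (a ord0 ord0 * s + (b *m col_of_tuple p) ord0 ord0)%R).
Proof.
rewrite /tmul col_of_tcons mul_block_col tuple_of_col_mx; congr (tcons (_, _)).
  apply: eq_from_tnth => i; rewrite !tnth_mktuple mxE; congr (_ + _)%R.
  by rewrite mul_mx_scalar.
by rewrite mxE mul_mx_scalar mxE mulrC.
Qed.

Lemma tmul1 (R : realType) (n : nat) (t : n.-tuple R) : tmul 1%:M%R t = t.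
Proof. by rewrite /tmul mul1mx col_of_tupleK. Qed.

Lemma tadd0 (R : realType) (n : nat) (t : n.-tuple R) :
  tadd (tuple_of_col 0%R) t = t.
Proof.
by apply: eq_from_tnth => i; rewrite !tnth_mktuple mxE add0r.
Qed.

Lemma tuple0_all (T : Type) (s t : 0.-tuple T) : s = t.
Proof. by rewrite (tuple0 s) (tuple0 t). Qed.

Lemma ge0_integral_translate (R : realType) (b : R) (f : R -> \bar R) :
  measurable_fun [set: R] f -> (forall x, 0 <= f x) ->
  \int[lebesgue_measure]_x f (b + x)%R = \int[lebesgue_measure]_x f x.
Proof.
move=> mf f0; rewrite -(@ge0_integral_affine _ 1%R b _ f)// normr1 mul1e.
by apply: eq_integral => x _; rewrite mul1r addrC.
Qed.

Lemma lebn_translate (R : realType) (n : nat) (v : n.-tuple R)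
    (f : n.-tuple R -> \bar R) :
  measurable_fun [set: n.-tuple R] f -> (forall t, 0 <= f t) ->
  \int[lebn R n]_t f (tadd v t) = \int[lebn R n]_t f t.
Proof.
elim: n v f => [|n IH] v f mf f0.
  by apply: eq_integral => t _; congr f; exact: tuple0_all.
have mfv : measurable_fun [set: n.+1.-tuple R] (fun t => f (tadd v t)).
  by apply: measurableT_comp => //; exact: measurable_tadd.
rewrite (lebnS mfv); last by move=> t; exact: f0.
rewrite (lebnS mf f0).
pose v' : n.-tuple R := [tuple tnth v (lift ord0 j) | j < n].
pose g s := \int[lebn R n]_p f (tcons (p, s)).
rewrite -(@ge0_integral_translate _ (tnth v ord0) g); first last.
- by move=> s; exact: integral_ge0.
- exact: measurable_lebn_section.
apply: eq_integral => s _; rewrite /g.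
rewrite -(IH v' (fun p => f (tcons (p, tnth v ord0 + s)%R)))//; last first.
  exact: measurable_section1.
apply: eq_integral => p _; congr f; apply: eq_from_tnth => i.
rewrite tnth_mktuple; case: (unliftP ord0 i) => [j ->|->].
  by rewrite !tnth_tconsS !tnth_mktuple.
by rewrite !tnth_tcons0.
Qed.

(** The change of variables formula for the linear map [M]. *)
Definition scales_lebn (R : realType) (n : nat) (M : 'M[R]_n) :=
  forall f : n.-tuple R -> \bar R,
  measurable_fun [set: n.-tuple R] f -> (forall t, 0 <= f t) ->
  `|\det M|%:E * \int[lebn R n]_t f (tmul M t) = \int[lebn R n]_t f t.

Section linear.
Context (R : realType).

Lemma scales_lebnM (n : nat) (A B : 'M[R]_n) :
  scales_lebn A -> scales_lebn B -> scales_lebn (A *m B)%R.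
Proof.
move=> hA hB f mf f0; rewrite -(hA f)// -(hB (f \o tmul A)); last 2 first.
- by apply: measurableT_comp => //; exact: measurable_tmul.
- by move=> t; exact: f0.
rewrite det_mulmx normrM EFinM -muleA; congr (_ * (_ * _)).
by apply: eq_integral => t _; rewrite tmulM.
Qed.

(** [(s, p) |-> (s, p + s b)] translates each slice [s] by [s b]. *)
Lemma scales_lebn_lower (n : nat) (b : 'cV[R]_n) :
  scales_lebn (block_mx 1%:M 0 b 1%:M : 'M[R]_(1 + n))%R.
Proof.
move=> f mf f0; rewrite det_lblock !det1 mulr1 normr1 mul1e.
have mfM := measurableT_comp mf
  (measurable_tmul (block_mx 1%:M 0 b 1%:M : 'M[R]_(1 + n))%R).
rewrite (lebnS mfM); last by move=> t; exact: f0.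
rewrite (lebnS mf f0); apply: eq_integral => s _.
rewrite -(@lebn_translate _ _ (tuple_of_col (s *: b)%R)
  (fun p => f (tcons (p, s)))); last 2 first.
- exact: (measurable_section1 mf).
- by move=> t; exact: f0.
apply: eq_integral => p _ /=; rewrite tmul_block tmul1 mul0mx.
by rewrite !mxE eqxx mul1r addr0.
Qed.

(** [(s, p) |-> (s + a p, p)] translates each slice [p] by [a p]. *)
Lemma scales_lebn_upper (n : nat) (a : 'rV[R]_n) :
  scales_lebn (block_mx 1%:M a 0 1%:M : 'M[R]_(1 + n))%R.
Proof.
move=> f mf f0; rewrite det_ublock !det1 mulr1 normr1 mul1e.
have mfM := measurableT_comp mf
  (measurable_tmul (block_mx 1%:M a 0 1%:M : 'M[R]_(1 + n))%R).
rewrite (lebnS_swap mfM); last by move=> t; exact: f0.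
rewrite (lebnS_swap mf f0); apply: eq_integral => p _.
rewrite -(@ge0_integral_translate _ ((a *m col_of_tuple p) ord0 ord0)%R
  (fun s => f (tcons (p, s)))); last 2 first.
- exact: (measurable_section2 mf).
- by move=> t; exact: f0.
apply: eq_integral => s _ /=; rewrite tmul_block tmul1 scaler0 tadd0.
by rewrite !mxE eqxx mul1r addrC.
Qed.

Lemma scales_lebn_diag (n : nat) (c : R) (S : 'M[R]_n) :
  c != 0%R -> scales_lebn S ->
  scales_lebn (block_mx c%:M 0 0 S : 'M[R]_(1 + n))%R.
Proof.
move=> c0 hS f mf f0.
rewrite det_ublock det_scalar1 normrM EFinM -muleA.
have mfM := measurableT_comp mf
  (measurable_tmul (block_mx c%:M 0 0 S : 'M[R]_(1 + n))%R).
rewrite (lebnS mfM); last by move=> t; exact: f0.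
rewrite (lebnS mf f0).
have mg := measurable_lebn_section mf f0.
rewrite -(ge0_integral_affine 0%R c0 mg); last first.
  by move=> s; apply: integral_ge0.
congr (_ * _).
have mgc : measurable_fun [set: R]
    (fun s => \int[lebn R n]_p (f \o tmul (block_mx c%:M 0 0 S : 'M[R]_(1 + n)))
      (tcons (p, s))).
  by apply: (measurable_lebn_section mfM) => t; exact: f0.
rewrite -ge0_integralZl//; last first.
  by move=> s _; apply: integral_ge0 => p _; exact: f0.
apply: eq_integral => s _.
rewrite -(hS (fun p => f (tcons (p, c * s + 0)%R))); last 2 first.
- exact: (measurable_section1 mf).
- by move=> t; exact: f0.
congr (_ * _); apply: eq_integral => p _ /=.
rewrite tmul_block scaler0 tadd0 mul0mx mxE eqxx mulr1n.
by rewrite [X in (_ + X)%R]mxE.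
Qed.

(** Elimination in the first row and column reduces the dimension: after a
    shear making the corner entry nonzero, an invertible matrix is the product
    of a lower shear, a block diagonal matrix carrying the Schur complement,
    and an upper shear. *)
Lemma scales_lebn_unit (n : nat) (M : 'M[R]_n) : M \in unitmx -> scales_lebn M.
Proof.
elim: n M => [|n IH] M uM.
  move=> f mf f0; rewrite det_mx00 normr1 mul1e.
  by apply: eq_integral => t _; congr f; exact: tuple0_all.
have corner (N : 'M[R]_(1 + n)) : N \in unitmx ->
    ulsubmx N ord0 ord0 != 0%R -> scales_lebn N.
  move=> uN c0.
  set c := ulsubmx N ord0 ord0 in c0.
  have ulE : ulsubmx N = c%:M%R by rewrite [LHS]mx11_scalar.
  pose a := (c^-1 *: ursubmx N)%R; pose b := (c^-1 *: dlsubmx N)%R.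
  pose S := (drsubmx N - b *m ursubmx N)%R.
  have NE : N = (block_mx 1%:M 0 b 1%:M *m block_mx c%:M 0 0 S *m
                 block_mx 1%:M a 0 1%:M)%R.
    rewrite !mulmx_block !(mul1mx, mulmx1, mul0mx, mulmx0, addr0, add0r).
    rewrite -[LHS]submxK ulE; congr block_mx.
    - by rewrite mul_scalar_mx scalerA divff// scale1r.
    - by rewrite mul_mx_scalar scalerA divff// scale1r.
    - rewrite mul_mx_scalar scalerA divff// scale1r /S /a /b.
      by rewrite -scalemxAl -scalemxAr addrC subrK.
  have uS : S \in unitmx.
    move: uN; rewrite NE !unitmx_mul !unitmxE det_lblock det_ublock det_ublock.
    by rewrite !det1 !mulr1 unitr1 andbT det_scalar1 unitrM => /and3P[].
  rewrite NE; apply: scales_lebnM; last exact: scales_lebn_upper.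
  apply: scales_lebnM; first exact: scales_lebn_lower.
  by apply: scales_lebn_diag => //; exact: IH.
have [c0|/corner] := eqVneq (ulsubmx (M : 'M[R]_(1 + n)) ord0 ord0) 0%R;
  last exact.
pose N : 'M[R]_(1 + n) := M.
have [i bi0] : exists i, dlsubmx N i ord0 != 0%R.
  apply: contrapT => h.
  have b0 : dlsubmx N = 0%R.
    apply/matrixP => i j; rewrite (ord1 j) [RHS]mxE; apply/eqP/negPn/negP => bi.
    by apply: h; exists i.
  have dN : (\det N = 0)%R.
    rewrite -[N]submxK b0 det_ublock [ulsubmx N]mx11_scalar c0 det_scalar1.
    by rewrite mul0r.
  by move: uM; rewrite unitmxE [(\det M)%R]dN unitr0.
pose e := delta_mx (@ord0 0) i : 'rV[R]_n.
pose U (x : 'rV[R]_n) : 'M[R]_(1 + n) := block_mx 1%:M%R x 0%R 1%:M%R.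
have UU : (U (- e) *m U e)%R = 1%:M%R.
  rewrite mulmx_block !(mul1mx, mulmx1, mul0mx, mulmx0, addr0, add0r) subrr.
  by rewrite -scalar_mx_block.
have uU x : U x \in unitmx by rewrite unitmxE det_ublock !det1 mulr1 unitr1.
rewrite (_ : M = U (- e) *m (U e *m N))%R; last by rewrite mulmxA UU mul1mx.
apply: scales_lebnM; first exact: scales_lebn_upper.
apply: corner; first by rewrite unitmx_mul uU.
rewrite -[N]submxK mulmx_block block_mxKul mul1mx mxE c0 add0r.
by rewrite -rowE mxE.
Qed.

End linear.

(** * The Brunn-Minkowski inequality on the line *)

Lemma lebesgue_measure_preimage_affine (R : realType) (c b : R) (A : set R) :
  (0 < c)%R -> measurable A ->
  c%:E * lebesgue_measure [set x | A (c * x + b)%R] = lebesgue_measure A.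
Proof.
move=> c0 mA; rewrite (@lebesgue_measure_affine _ c b (lt0r_neq0 c0) _ mA).
by rewrite /mscale/= gtr0_norm.
Qed.

Lemma measurable_preimage_affine (R : realType) (c b : R) (A : set R) :
  measurable A -> measurable [set x : R | A (c * x + b)%R].
Proof.
by move=> mA; have := measurable_affine c b measurableT mA; rewrite setTI.
Qed.

(** Peeling off one set [A i]: in front of the cut [w i * q i + P], where [P]
    is the least element of the sum of the remaining sets, [C] contains a
    translate of [w i A i] without its last point; behind the cut it contains
    a translate of the sum of the remaining sets. *)
Lemma brunn_minkowski_seq (R : realType) (I : eqType) (s : seq I)
    (w p q : I -> R) (A : I -> set R) (C : set R) :
  uniq s -> (forall i, 0 <= w i)%R -> (forall i, measurable (A i)) ->
  (forall i, A i (p i)) -> (forall i, A i (q i)) ->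
  (forall i x, A i x -> p i <= x <= q i)%R -> measurable C ->
  (forall a : I -> R, (forall i, A i (a i)) -> C (\sum_(i <- s) w i * a i)%R) ->
  \sum_(i <- s) (w i)%:E * lebesgue_measure (A i) <= lebesgue_measure C.
Proof.
move=> us w0 mA Ap Aq Apq; elim: s us C => [|i s IH] /= us C mC hC.
  by rewrite big_nil.
case/andP: us => nis us; rewrite big_cons.
pose P := (\sum_(j <- s) w j * p j)%R; pose m := (w i * q i + P)%R.
rewrite (_ : C = (C `&` [set x | (x < m)%R]) `|`
                 (C `&` [set x | (m <= x)%R])); last first.
  rewrite -setIUr; apply/esym/setIidl => x _ /=.
  by have [|] := ltP x m; [left|right].
have m1 : measurable [set x : R | (x < m)%R].
  by have := @measurable_itv R `]-oo, m[; rewrite set_itvE.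
have m2 : measurable [set x : R | (m <= x)%R].
  by have := @measurable_itv R `[m, +oo[; rewrite set_itvE.
rewrite [leRHS]measureU; last 3 first.
- exact: measurableI.
- exact: measurableI.
- apply/seteqP; split => // x [[_ /= xm] [_ /= mx]].
  by move: xm; rewrite ltNge mx.
have aE a x : (\sum_(j <- i :: s) w j * (if j == i then x else a j) =
    w i * x + \sum_(j <- s) w j * a j)%R.
  rewrite big_cons eqxx; congr (_ + _)%R; apply: eq_big_seq => j js.
  by case: eqP => // ji; rewrite -ji js in nis.
have hC' a x : A i x -> (forall j, A j (a j)) ->
    C (w i * x + \sum_(j <- s) w j * a j)%R.
  by move=> Ax Aa; rewrite -aE; apply: hC => j; case: eqP => [->|].
apply: leeD.
- have := w0 i; rewrite le_eqVlt => /predU1P[<-|wi0]; first by rewrite mul0e.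
  rewrite -[leRHS](@lebesgue_measure_preimage_affine _ _ P _ wi0
    (measurableI _ _ mC m1)).
  rewrite lee_pmul2l ?lte_fin// (_ : A i = (A i `\ q i) `|` [set q i]); last first.
    by rewrite setUC setDUK// => x ->.
  have mD : measurable (A i `\ q i) by exact: measurableD.
  rewrite [leLHS](measureU0 _ _ (lebesgue_measure_set1 (q i)))//.
  apply: le_measure; rewrite ?inE//.
    by apply: measurable_preimage_affine; exact: measurableI.
  move=> x [Ax /= xq]; split; first exact: hC'.
  rewrite /= ltrD2r ltr_pM2l// lt_neqAle.
  by have /andP[_ ->] := Apq _ _ Ax; rewrite andbT; exact/eqP.
- rewrite -[leRHS](@lebesgue_measure_preimage_affine _ _ (w i * q i)%R _ ltr01
    (measurableI _ _ mC m2)).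
  rewrite mul1e; apply: IH => //.
    by apply: measurable_preimage_affine; exact: measurableI.
  move=> a Aa /=; rewrite mul1r addrC; split; first exact: hC'.
  rewrite /= lerD2l; apply: ler_sum => j _; apply: ler_wpM2l => //.
  by have /andP[] := Apq _ _ (Aa j).
Qed.

(** The sets need not contain their bounds, so they are first cut down to the
    part between two of their points, at a cost of at most [e] in measure. *)
Lemma brunn_minkowski1 (R : realType) (I : finType) (w : I -> R)
    (A : I -> set R) (C : set R) (rho : R) :
  (forall i, 0 <= w i)%R -> (\sum_i w i = 1)%R ->
  (forall i, measurable (A i)) -> (forall i, A i !=set0) ->
  (forall i x, A i x -> `|x| <= rho)%R -> measurable C ->
  (forall a : I -> R, (forall i, A i (a i)) -> C (\sum_i w i * a i)%R) ->
  \sum_i (w i)%:E * lebesgue_measure (A i) <= lebesgue_measure C.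
Proof.
move=> w0 w1 mA A0 Arho mC hC; apply/lee_addgt0Pr => e e0.
have bd i : has_sup (A i) /\ has_inf (A i).
  split; split => //; [exists rho => x|exists (- rho)%R => x] => /Arho;
  by rewrite ler_norml => /andP[].
have e20 : (0 < e / 2)%R by rewrite divr_gt0.
have /choice[pq hpq] i : exists pq : R * R, [/\ A i pq.1, A i pq.2,
    (pq.1 <= pq.2)%R, (pq.1 < inf (A i) + e / 2)%R & (sup (A i) - e / 2 < pq.2)%R].
  have [hs hi] := bd i.
  have [p Ap pi] := inf_adherent e20 hi.
  have [q Aq qs] := sup_adherent e20 hs.
  have [pq|qp] := leP p q; first by exists (p, q).
  by exists (p, p); split => //=; exact: (lt_trans qs).
pose A' i := A i `&` `[(pq i).1, (pq i).2].
have mA' i : measurable (A' i) by exact: measurableI.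
have AA' i : lebesgue_measure (A i) <= lebesgue_measure (A' i) + e%:E.
  have [Ap Aq p_le_q pinf qsup] := hpq i; have [hs hi] := bd i.
  pose K1 := `[inf (A i), (inf (A i) + e / 2)%R]%classic.
  pose K2 := `[(sup (A i) - e / 2)%R, sup (A i)]%classic.
  have K1e : lebesgue_measure K1 = (e / 2)%:E.
    rewrite /K1 [LHS]lebesgue_measure_itv/= lte_fin ltrDl e20 -EFinB.
    by congr EFin; rewrite addrAC subrr add0r.
  have K2e : lebesgue_measure K2 = (e / 2)%:E.
    rewrite /K2 [LHS]lebesgue_measure_itv/= lte_fin ltrBlDr ltrDl e20 -EFinB.
    by congr EFin; rewrite opprB addrC subrK.
  have mK : measurable (K1 `|` K2) by apply: measurableU; exact: measurable_itv.
  have mU := measurableU _ _ (mA' i) mK.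
  apply: (@le_trans _ _ (lebesgue_measure (A' i `|` (K1 `|` K2)))).
    apply: le_measure; rewrite ?inE; [exact: mA|exact: mU|].
    move=> x Ax; have [xp|px] := ltP x (pq i).1.
      right; left; rewrite /K1/= in_itv/= ge_inf ?(ltW (lt_trans xp _))//.
      by case: hi.
    have [xq|qx] := leP x (pq i).2; first by left; split; rewrite //= in_itv/= px.
    right; right; rewrite /K2/= in_itv/= ub_le_sup//; last by case: hs.
    by rewrite (ltW (lt_trans qsup qx)).
  apply: (le_trans (measureU2 (@lebesgue_measure R) (mA' i) mK)).
  rewrite leeD2l//.
  apply: (le_trans (measureU2 (@lebesgue_measure R) (measurable_itv _)
    (measurable_itv _))).
  by rewrite [X in X + _]K1e [X in _ + X]K2e -EFinD -splitr.
apply: (@le_trans _ _ (\sum_i (w i)%:E * (lebesgue_measure (A' i) + e%:E))).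
  by apply: lee_sum => i _; rewrite lee_wpmul2l// lee_fin.
under eq_bigr do rewrite ge0_muleDr// ?lee_fin ?(ltW e0)//.
rewrite big_split/=; apply: leeD; last first.
  under eq_bigr do rewrite -EFinM.
  by rewrite sumEFin -mulr_suml w1 mul1r.
apply: (@brunn_minkowski_seq _ _ _ w (fun i => (pq i).1) (fun i => (pq i).2)) => //.
- exact: index_enum_uniq.
- by move=> i; have [? ? pq_ _ _] := hpq i; split; rewrite //= in_itv/= lexx pq_.
- by move=> i; have [? ? pq_ _ _] := hpq i; split; rewrite //= in_itv/= lexx pq_.
- by move=> i x [_]; rewrite /= in_itv.
- by move=> a Aa; apply: hC => i; case: (Aa i).
Qed.

(** * The Prekopa-Leindler inequality *)

Lemma weighted_AM_GM (R : realType) (I : finType) (w X : I -> R) :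
  (forall i, 0 <= w i)%R -> (\sum_i w i = 1)%R -> (forall i, 0 < X i)%R ->
  (expR (\sum_i w i * ln (X i)) <= \sum_i w i * X i)%R.
Proof.
move=> w0 w1 X0; set c := (\sum_i w i * ln (X i))%R.
(* The tangent of expR at c bounds X i = expR (ln (X i)) from below; the linear
   terms cancel in the weighted mean because c is the mean of the ln (X i). *)
have h i : (w i * (expR c * (1 + (ln (X i) - c))) <= w i * X i)%R.
  rewrite ler_wpM2l// -{2}(@lnK R (X i)); last by rewrite posrE.
  rewrite -{2}(subrK c (ln (X i))) addrC expRD mulrC ler_wpM2r ?expR_ge0//.
  by rewrite addrC expR_ge1Dx.
apply: le_trans (ler_sum _ (fun i _ => h i)).
rewrite (eq_bigr (fun i => expR c * (w i + w i * ln (X i) - w i * c)))%R;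
  last first.
  by move=> i _; ring.
rewrite -mulr_sumr sumrB big_split/= w1 -/c -mulr_suml w1 mul1r.
by rewrite addrK mulr1.
Qed.

Lemma tonelli_sections (R : realType) (A : set (R * R)) : measurable A ->
  \int[lebesgue_measure]_x lebesgue_measure (xsection A x) =
  \int[lebesgue_measure]_t lebesgue_measure (ysection A t).
Proof.
move=> mA.
have := @indic_fubini_tonelli _ _ _ _ R (@lebesgue_measure R)
  (@lebesgue_measure R) A mA.
by rewrite indic_fubini_tonelli_FE// indic_fubini_tonelli_GE.
Qed.

Lemma measurable_setb d (T : measurableType d) (b : T -> bool) :
  measurable_fun setT b -> measurable [set x | b x].
Proof. by move=> mb; rewrite -[X in measurable X]setTI; exact: mb. Qed.

Section layer_cake.
Context (R : realType).
Local Notation mu := (@lebesgue_measure R).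

Let mt : measurable_fun [set: R * R] (fun p : R * R => (0 < p.2 < 1)%R).
Proof. by apply: measurable_and; apply: measurable_fun_ltr. Qed.

(** Tonelli's theorem for the region under the graph of [F / S]: no level above
    1 is reached because [F <= S]. *)
Lemma layer_cake (F : R -> R) (S : R) : measurable_fun [set: R] F ->
  (forall x, 0 <= F x <= S)%R -> (0 < S)%R ->
  \int[mu]_(t in `]0%R, 1%R[) mu [set x | (S * t < F x)%R] =
  \int[mu]_x (S^-1 * F x)%:E.
Proof.
move=> mF F0S S0.
pose A := [set p : R * R | (0 < p.2 < 1)%R && (S * p.2 < F p.1)%R].
have mA : measurable A.
  apply: measurable_setb; apply: measurable_and => //.
  apply: measurable_fun_ltr; first exact: measurable_funM.
  exact: measurableT_comp.
transitivity (\int[mu]_t mu (ysection A t)).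
  rewrite integral_mkcond; apply: eq_integral => t _; rewrite patchE.
  rewrite mem_setE in_itv/=; case: ifPn => t01.
    by congr (mu _); apply/seteqP; split=> x; rewrite /ysection /= inE /A/= t01.
  rewrite (_ : ysection A t = set0) ?measure0//.
  by apply/seteqP; split=> x //; rewrite /ysection /= inE /A/= (negbTE t01).
rewrite -(tonelli_sections mA); apply: eq_integral => x _.
have /andP[F0 FS] := F0S x.
have FS1 : (S^-1 * F x <= 1)%R by rewrite mulrC ler_pdivrMr// mul1r.
rewrite (_ : xsection A x = `]0%R, (S^-1 * F x)%R[%classic); last first.
  apply/seteqP; split=> t; rewrite /xsection /= inE /A/= in_itv/=.
    move=> /andP[/andP[-> _]]; rewrite -ltr_pdivlMl//.
  move=> /andP[t0 tF]; rewrite t0 (lt_le_trans tF)//=.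
  by rewrite -ltr_pdivlMl.
rewrite [LHS]lebesgue_measure_itv/= lte_fin oppr0 adde0.
case: ltP => // FS0; congr EFin; apply/le_anti.
by rewrite FS0 mulr_ge0// invr_ge0 ltW.
Qed.

(** Here [H] may exceed [P], and the levels above 1 are dropped. *)
Lemma layer_cake_le (H : R -> \bar R) (P : R) : measurable_fun [set: R] H ->
  (forall x, 0 <= H x) -> (0 < P)%R ->
  \int[mu]_(t in `]0%R, 1%R[) mu [set x | (P * t)%:E <= H x] <=
  \int[mu]_x (P^-1%:E * H x).
Proof.
move=> mH H0 P0.
pose A := [set p : R * R | (0 < p.2 < 1)%R && ((P * p.2)%:E <= H p.1)].
have mA : measurable A.
  apply: measurable_setb; apply: measurable_and => //.
  apply: measurable_fun_lee; last exact: measurableT_comp.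
  by apply/measurable_EFinP; exact: measurable_funM.
rewrite [leLHS](_ : _ = \int[mu]_t mu (ysection A t)); last first.
  rewrite integral_mkcond; apply: eq_integral => t _; rewrite patchE.
  rewrite mem_setE in_itv/=; case: ifPn => t01.
    by congr (mu _); apply/seteqP; split=> x; rewrite /ysection /= inE /A/= t01.
  rewrite (_ : ysection A t = set0) ?measure0//.
  by apply/seteqP; split=> x //; rewrite /ysection /= inE /A/= (negbTE t01).
rewrite -(tonelli_sections mA); apply: ge0_le_integral => //.
- exact: measurable_fun_xsection.
- exact: measurable_funeM.
move=> x _.
have := H0 x; case HE : (H x) => [h| |]// h0; last first.
  by rewrite mulry gtr0_sg ?invr_gt0// mul1e leey.
rewrite lee_fin in h0.
apply: (@le_trans _ _ (mu `[0%R, (P^-1 * h)%R])).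
  apply: le_measure; rewrite ?inE;
    [exact: measurable_xsection|exact: measurable_itv|].
  move=> t; rewrite /xsection /= inE /A/= HE lee_fin in_itv/=.
  by move=> /andP[/andP[t0 _]]; rewrite (ltW t0) -ler_pdivlMl.
rewrite [leLHS]lebesgue_measure_itv/= lte_fin oppr0 adde0 -EFinM.
by case: ltP => // _; rewrite lee_fin mulr_ge0// invr_ge0 ltW.
Qed.

End layer_cake.

(** The level sets [S i * t < F i] and [P * t <= H], with [S i = sup F i] and
    [P] the geometric mean of the [S i], satisfy the hypothesis of the
    Brunn-Minkowski inequality; integrating over [t] bounds the integral of [H]
    by an arithmetic mean of normalised integrals, hence by a geometric one. *)
Theorem prekopa_leindler1 (R : realType) (I : finType) (w : I -> R)
    (F : I -> R -> R) (H : R -> \bar R) (M rho : R) (K : I -> R) :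
  (forall i, 0 <= w i)%R -> (\sum_i w i = 1)%R ->
  (forall i, measurable_fun [set: R] (F i)) -> (forall i x, 0 <= F i x <= M)%R ->
  (forall i x, 0 < F i x -> `|x| <= rho)%R ->
  measurable_fun [set: R] H -> (forall x, 0 <= H x) ->
  (forall y : I -> R, (forall i, 0 < F i (y i))%R ->
    (expR (\sum_i w i * ln (F i (y i))))%:E <= H (\sum_i w i * y i)%R) ->
  (forall i, \int[lebesgue_measure]_x (F i x)%:E = (K i)%:E) ->
  (forall i, 0 < K i)%R ->
  (expR (\sum_i w i * ln (K i)))%:E <= \int[lebesgue_measure]_x H x.
Proof.
move=> w0 w1 mF F0M Frho mH H0 hFH FK K0.
pose S i := sup (range (F i)).
have hS i : has_sup (range (F i)).
  split; first by exists (F i 0%R), 0%R.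
  by exists M => _ [x _ <-]; have /andP[] := F0M i x.
have FS i x : (F i x <= S i)%R by apply: ub_le_sup; [case: (hS i)|exists x].
have S0 i : (0 < S i)%R.
  rewrite ltNge; apply/negP => Si0; have := K0 i.
  rewrite -lte_fin -FK integral0_eq ?ltxx// => x _.
  congr EFin; apply/le_anti; rewrite (le_trans (FS i x) Si0).
  by have /andP[] := F0M i x.
pose P := expR (\sum_i w i * ln (S i))%R.
have P0 : (0 < P)%R by exact: expR_gt0.
have mL i t : measurable [set x | (S i * t < F i x)%R].
  by apply: measurable_setb; exact: measurable_fun_ltr.
have mC t : measurable [set x | (P * t)%:E <= H x].
  by apply: measurable_setb; exact: measurable_fun_lee.
have BM t : (0 < t < 1)%R ->
    \sum_i (w i)%:E * lebesgue_measure [set x | (S i * t < F i x)%R] <=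
    lebesgue_measure [set x | (P * t)%:E <= H x].
  move=> /andP[t0 t1]; apply: (@brunn_minkowski1 _ _ _ _ _ rho) => //.
  - move=> i; have : (0 < S i - S i * t)%R.
      by rewrite subr_gt0 gtr_pMr.
    move=> /sup_adherent/(_ (hS i)) [_ [x _ <-]]; rewrite opprB addrC subrK => h.
    by exists x.
  - move=> i x /= h; apply: (Frho i); apply: le_lt_trans h.
    by rewrite mulr_ge0// ltW.
  - move=> a /= ha.
    have Fa i : (0 < F i (a i))%R.
      by apply: le_lt_trans (ha i); rewrite mulr_ge0// ltW.
    apply: le_trans (hFH a Fa).
    rewrite lee_fin -{1}(@lnK _ t) ?posrE// -expRD ler_expR.
    rewrite -[ln t]mul1r -w1 mulr_suml -big_split/=; apply: ler_sum => i _.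
    rewrite -mulrDr ler_wpM2l// -lnM ?posrE// ler_ln ?posrE ?mulr_gt0//.
    exact: ltW.
have mI : measurable (`]0%R, 1%R[%classic : set R) by exact: measurable_itv.
have mFt i : measurable_fun [set: R]
    (fun t => lebesgue_measure [set x | (S i * t < F i x)%R]).
  pose A := [set p : R * R | (S i * p.2 < F i p.1)%R].
  have mA : measurable A.
    apply: measurable_setb; apply: measurable_fun_ltr; first exact: measurable_funM.
    exact: measurableT_comp.
  rewrite (_ : (fun _ => _) = lebesgue_measure \o ysection A).
    exact: measurable_fun_ysection.
  apply/funext => t /=; congr (lebesgue_measure _).
  by apply/seteqP; split => x; rewrite /ysection/= inE.
have mHt : measurable_fun [set: R]
    (fun t => lebesgue_measure [set x | (P * t)%:E <= H x]).
  pose A := [set p : R * R | (P * p.2)%:E <= H p.1].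
  have mA : measurable A.
    apply: measurable_setb; apply: measurable_fun_lee; last exact: measurableT_comp.
    by apply/measurable_EFinP; exact: measurable_funM.
  rewrite (_ : (fun _ => _) = lebesgue_measure \o ysection A).
    exact: measurable_fun_ysection.
  apply/funext => t /=; congr (lebesgue_measure _).
  by apply/seteqP; split => x; rewrite /ysection/= inE.
have : \int[lebesgue_measure]_(t in `]0%R, 1%R[)
      (\sum_i (w i)%:E * lebesgue_measure [set x | (S i * t < F i x)%R]) <=
    \int[lebesgue_measure]_x (P^-1%:E * H x).
  apply: le_trans (layer_cake_le mH H0 P0); apply: ge0_le_integral => //.
  - by move=> t _; apply: sume_ge0 => i _; rewrite mule_ge0// lee_fin.
  - apply: emeasurable_sum => i; apply: measurable_funeM.
    by apply: measurable_funTS; exact: mFt.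
  - by apply: measurable_funTS; exact: mHt.
rewrite ge0_integral_sum//; last 2 first.
- by move=> i; apply: measurable_funeM; apply: measurable_funTS; exact: mFt.
- by move=> i t _; rewrite mule_ge0// lee_fin.
rewrite ge0_integralZl//; last by rewrite lee_fin invr_ge0 ltW.
rewrite (eq_bigr (fun i => (w i * (K i / S i))%:E)); last first.
  move=> i _; rewrite ge0_integralZl//; last 2 first.
  - by apply: measurable_funTS; exact: mFt.
  - by rewrite lee_fin.
  rewrite layer_cake//; last first.
    by move=> x; rewrite FS andbT; have /andP[] := F0M i x.
  under eq_integral do rewrite EFinM.
  rewrite ge0_integralZl//; last 3 first.
  - by apply/measurable_EFinP; exact: mF.
  - by move=> x _; rewrite lee_fin; have /andP[] := F0M i x.
  - by rewrite lee_fin invr_ge0 ltW.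
  by rewrite [X in _ * (_ * X)]FK -!EFinM [(_^-1 * _)%R]mulrC.
rewrite sumEFin lee_pdivlMl// -EFinM; apply: le_trans.
rewrite lee_fin.
have KS i : (0 < K i / S i)%R by rewrite divr_gt0.
apply: le_trans (ler_wpM2l (ltW P0) (weighted_AM_GM w0 w1 KS)).
rewrite -expRD ler_expR -big_split/=; apply: ler_sum => i _.
by rewrite -mulrDr -lnM ?posrE// [(S i * _)%R]mulrC divfK ?gt_eqF.
Qed.

Definition twsum (R : realType) (I : finType) (n : nat) (w : I -> R)
  (y : I -> n.-tuple R) : n.-tuple R :=
  [tuple (\sum_i w i * tnth (y i) j)%R | j < n].

Lemma twsum_tcons (R : realType) (I : finType) (n : nat) (w : I -> R)
    (p : I -> n.-tuple R) (s : I -> R) :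
  twsum w (fun i => tcons (p i, s i)) =
  tcons (twsum w p, \sum_i w i * s i)%R.
Proof.
apply: eq_from_tnth => j; rewrite tnth_mktuple.
case: (unliftP ord0 j) => [k ->|->].
  rewrite tnth_tconsS tnth_mktuple; apply: eq_bigr => i _.
  by rewrite tnth_tconsS.
by rewrite tnth_tcons0; apply: eq_bigr => i _; rewrite tnth_tcons0.
Qed.

Lemma cube_tcons (R : realType) (n : nat) (rho : R) (p : n.-tuple R) (s : R) :
  cube n.+1 rho (tcons (p, s)) <-> cube n rho p /\ (`|s| <= rho)%R.
Proof.
split=> [h|[hp hs] i].
  split; last by have := h ord0; rewrite tnth_tcons0.
  by move=> i; have := h (lift ord0 i); rewrite tnth_tconsS.
case: (unliftP ord0 i) => [j ->|->]; first by rewrite tnth_tconsS.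
by rewrite tnth_tcons0.
Qed.

Lemma ge0_integral_le_cube (R : realType) (n : nat) (f : n.-tuple R -> \bar R)
    (M rho : R) : measurable_fun [set: n.-tuple R] f ->
  (forall t, 0 <= f t <= M%:E) -> (forall t, 0 < f t -> cube n rho t) ->
  \int[lebn R n]_t f t <= M%:E * lebn R n (cube n rho).
Proof.
move=> mf f0M fc.
have M0 : (0 <= M)%R.
  by have /andP[h1 h2] := f0M [tuple 0%R | _ < n]; have := le_trans h1 h2.
rewrite -(setIT (cube n rho)) -integral_indic//; last exact: measurable_cube.
have mi : measurable_fun [set: n.-tuple R] (fun t => (\1_(cube n rho) t : R)%:E).
  apply/measurable_EFinP; apply: measurable_indic; exact: measurable_cube.
rewrite -ge0_integralZl//.
apply: ge0_le_integral => //.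
- by move=> t _; have /andP[] := f0M t.
- exact: measurable_funeM.
move=> t _; have /andP[f0 fM] := f0M t.
have := f0; rewrite le_eqVlt => /predU1P[<-|/fc ct].
  by rewrite mule_ge0// lee_fin.
by rewrite indicE mem_set// mule1.
Qed.

(** Induction on the dimension: the slices of the [F i] and of [H] satisfy the
    hypothesis in dimension n, and its conclusion is the hypothesis of the
    one-dimensional inequality for the integrals over the slices. *)
Theorem prekopa_leindler (R : realType) (n : nat) (I : finType) (w : I -> R)
    (F : I -> n.-tuple R -> R) (H : n.-tuple R -> \bar R) (M rho : R)
    (K : I -> R) :
  (forall i, 0 <= w i)%R -> (\sum_i w i = 1)%R ->
  (forall i, measurable_fun [set: n.-tuple R] (F i)) ->
  (forall i t, 0 <= F i t <= M)%R -> (forall i t, 0 < F i t -> cube n rho t)%R ->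
  measurable_fun [set: n.-tuple R] H -> (forall t, 0 <= H t) ->
  (forall y : I -> n.-tuple R, (forall i, 0 < F i (y i))%R ->
    (expR (\sum_i w i * ln (F i (y i))))%:E <= H (twsum w y)) ->
  (forall i, \int[lebn R n]_t (F i t)%:E = (K i)%:E) ->
  (forall i, 0 < K i)%R ->
  (expR (\sum_i w i * ln (K i)))%:E <= \int[lebn R n]_t H t.
Proof.
move=> w0 w1; elim: n F H K => [|n IH] F H K mF F0M Frho mH H0 hFH FK K0.
  have FKE i : F i [tuple] = K i.
    apply: EFin_inj; rewrite -FK [RHS]integral_dirac//; last first.
      by apply/measurable_EFinP; exact: mF.
    by rewrite diracE mem_set// mul1e.
  rewrite [leRHS]integral_dirac// diracE mem_set// mul1e.
  rewrite (_ : [tuple] = twsum w (fun i : I => [tuple])); last exact: tuple0_all.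
  rewrite (eq_bigr (fun i => w i * ln (F i [tuple]))%R); last first.
    by move=> i _; rewrite FKE.
  by apply: hFH => i; rewrite FKE.
have F0 i t : 0 <= (F i t)%:E by rewrite lee_fin; have /andP[] := F0M i t.
have mFE i : measurable_fun [set: n.+1.-tuple R] (fun t => (F i t)%:E).
  by apply/measurable_EFinP; exact: mF.
pose c := fine (lebn R n (cube n rho)).
have cE : lebn R n (cube n rho) = c%:E.
  by rewrite fineK// ge0_fin_numE ?measure_ge0//; exact: lebesgue_n_cube.
pose G i s := \int[lebn R n]_p (F i (tcons (p, s)))%:E.
have G0 i s : 0 <= G i s by apply: integral_ge0.
have GM i s : G i s <= (M * c)%:E.
  rewrite EFinM -cE; apply: ge0_integral_le_cube.
  - exact: (measurable_section1 (mFE i)).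
  - by move=> p; rewrite F0 lee_fin; have /andP[] := F0M i (tcons (p, s)).
  - by move=> p; rewrite lte_fin => /Frho /cube_tcons[].
have Gfin i s : G i s = (fine (G i s))%:E.
  by rewrite fineK// ge0_fin_numE// (le_lt_trans (GM i s))// ltry.
have mG i : measurable_fun [set: R] (G i).
  exact: (measurable_lebn_section (mFE i)).
rewrite (lebnS mH H0).
apply: (@prekopa_leindler1 _ _ _ (fun i s => fine (G i s)) _ (M * c)%R rho) => //.
- by move=> i; exact: measurableT_comp.
- by move=> i s; rewrite -!lee_fin -Gfin G0 GM.
- move=> i s; rewrite ltNge => /negP h; rewrite leNgt; apply/negP => hs; apply: h.
  rewrite -lee_fin -Gfin /G integral0_eq// => p _.
  congr EFin; apply/le_anti; have /andP[-> _] := F0M i (tcons (p, s)).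
  rewrite andbT leNgt; apply/negP => /Frho /cube_tcons[_].
  by rewrite leNgt hs.
- exact: (measurable_lebn_section mH H0).
- by move=> s; apply: integral_ge0.
- move=> s Gs; apply: (IH (fun i p => F i (tcons (p, s i)))) => //.
  + by move=> i; apply/measurable_EFinP; exact: (measurable_section1 (mFE i)).
  + by move=> i p /Frho /cube_tcons[].
  + exact: (measurable_section1 mH).
  + by move=> p Fp; rewrite -twsum_tcons; exact: hFH.
  + by move=> i; rewrite -Gfin.
- move=> i; rewrite -FK (lebnS (mFE i) (F0 i)); apply: eq_integral => s _.
  by rewrite -Gfin.
Qed.

(** * Lower semicontinuous functions *)

Section sup_norm.
Context (R : realType) (n : nat).
Implicit Types x y : 'cV[R]_n.

Lemma coord_le_norm x i : (`|x i ord0| <= `|x|)%R.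
Proof.
rewrite [leRHS]mx_normrE; apply/bigmax_geP; right => /=.
by exists (i, ord0).
Qed.

Lemma norm_leP x (r : R) : (0 <= r)%R ->
  (`|x| <= r)%R <-> (forall i, `|x i ord0| <= r)%R.
Proof.
move=> r0; split=> [xr i|h]; first exact: le_trans (coord_le_norm x i) xr.
rewrite [leLHS]mx_normrE; apply/bigmax_leP; split => // -[i j] _ /=.
by rewrite (ord1 j).
Qed.

Lemma norm_ltP x (r : R) : (0 < r)%R ->
  (`|x| < r)%R <-> (forall i, `|x i ord0| < r)%R.
Proof.
move=> r0; split=> [xr i|h]; first exact: le_lt_trans (coord_le_norm x i) xr.
rewrite [ltLHS]mx_normrE; apply/bigmax_ltP; split => // -[i j] _ /=.
by rewrite (ord1 j).
Qed.

Lemma nbhs_normP x (V : set 'cV[R]_n) : nbhs x V ->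
  exists2 e : R, (0 < e)%R & forall y, (`|y - x| < e)%R -> V y.
Proof.
move=> /nbhs_ballP[e /= e0 eV]; exists e => // y yx; apply: eV.
by rewrite mx_norm_ball /ball_/= distrC.
Qed.

Lemma norm_nbhs x (V : set 'cV[R]_n) (e : R) : (0 < e)%R ->
  (forall y, (`|y - x| < e)%R -> V y) -> nbhs x V.
Proof.
move=> e0 eV; apply/nbhs_ballP; exists e => //= y.
by rewrite mx_norm_ball /ball_/= distrC => /eV.
Qed.

Lemma compact_norm_le (r : R) : compact [set x : 'cV[R]_n | (`|x| <= r)%R].
Proof.
pose B := [set v : 'rV[R]_n | forall i, `|v ord0 i|%R <= r]%R.
have cB : compact B.
  have := @rV_compact R n (fun=> `[(- r)%R, r]%classic)
    (fun=> @segment_compact _ _ _).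
  congr compact; apply/seteqP; split=> v h i; have := h i;
    by rewrite /= in_itv/= ler_norml.
have [r0|r0] := leP 0%R r; last first.
  rewrite (_ : [set _ | _] = set0); first exact: compact0.
  by apply/seteqP; split=> // x /= xr; have := le_lt_trans xr r0; rewrite normr_lt0.
rewrite (_ : [set x | _] = [set v^T%R | v in B]); last first.
  apply/seteqP; split=> [x /(norm_leP _ r0) xr|_ [v vr <-]].
    by exists x^T%R; rewrite ?trmxK// => i; rewrite mxE.
  by apply/(norm_leP _ r0) => i; rewrite mxE; exact: vr.
apply: continuous_compact => //; apply: continuous_subspaceT => v A [P Pv PA].
exists (fun i j => P j i) => [i j|w Pw]; first by have := Pv j i; rewrite mxE.
by apply: PA => i j; rewrite mxE; exact: Pw.
Qed.

End sup_norm.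

Section lsc.
Context (R : realType).

Lemma ereal_between (x : \bar R) (a : R) : a%:E < x ->
  exists2 b : R, (a < b)%R & b%:E < x.
Proof.
case: x => [x| |] //; rewrite ?lte_fin => ax.
  by exists ((a + x) / 2)%R; rewrite ?lte_fin; lra.
by exists (a + 1)%R; rewrite ?ltry// ltrDl.
Qed.

Lemma ereal_gtNy (x : \bar R) : -oo < x -> exists b : R, b%:E < x.
Proof.
case: x => [x| |] // _; last by exists 0%R; rewrite ltry.
by exists (x - 1)%R; rewrite lte_fin ltrBlDr ltrDl.
Qed.

Context (X : topologicalType).
Implicit Types (phi : X -> \bar R) (K : set X).

(** Each point of [K] satisfies the bound with its own [k], hence so does a
    neighbourhood of it with all later [k]; compactness gives a common [k]. *)
Lemma lsc_compact_gt phi K (a : nat -> R) : lower_semicontinuous phi ->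
  compact K -> {homo a : i j / (i <= j)%N >-> (j <= i)%R} ->
  (forall x, K x -> exists k, (a k)%:E < phi x) ->
  exists k, forall x, K x -> (a k)%:E < phi x.
Proof.
move=> lphi /compact_near_coveringP cK da h.
have := cK nat \oo (fun k x => (a k)%:E < phi x) _.
move=> [x /h [k ak]|N _ hN]; last by exists N; exact: (hN N (leqnn N)).
have [V Vx Vphi] := lphi _ _ ak.
exists (V, [set j | (k <= j)%N]); first by split => //; exists k.
move=> [y j] [/= Vy kj]; apply: le_lt_trans (Vphi _ Vy).
by rewrite lee_fin da.
Qed.

Lemma lsc_compact_lbound phi K : lower_semicontinuous phi -> compact K ->
  (forall x, -oo < phi x) -> exists m : R, forall x, K x -> m%:E <= phi x.
Proof.
move=> lphi cK phiNy.
have [||k hk] := @lsc_compact_gt phi K (fun k => - k%:R)%R lphi cK.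
- by move=> i j ij; rewrite lerN2 ler_nat.
- move=> x _; have [b bx] := ereal_gtNy (phiNy x).
  exists (Num.truncn `|b|%R).+1; apply: lt_trans bx; rewrite lte_fin.
  rewrite ltrNl (le_lt_trans _ (truncnS_gt _))// -normrN ler_norm//.
by exists (- k%:R)%R => x /hk/ltW.
Qed.

(** Otherwise the values on [K] would all exceed the infimum [i], so by
    compactness all exceed [i + 1 / (k + 1)] for some [k]. *)
Lemma lsc_compact_min phi K : lower_semicontinuous phi -> compact K ->
  (forall x, -oo < phi x) -> K !=set0 ->
  exists2 x, K x & forall y, K y -> phi x <= phi y.
Proof.
move=> lphi cK phiNy [x0 Kx0]; have [m hm] := lsc_compact_lbound lphi cK phiNy.
pose i := ereal_inf [set phi x | x in K].
have ix x : K x -> i <= phi x by move=> Kx; apply: ereal_inf_lbound; exists x.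
apply: contrapT => hno.
have ilt x : K x -> i < phi x.
  move=> Kx; rewrite lt_neqAle ix// andbT; apply/eqP => ie.
  by apply: hno; exists x => // y /ix; rewrite ie.
have mi : m%:E <= i by apply: le_ereal_inf_tmp => _ [x Kx <-]; exact: hm.
have [r ir] : exists r : R, i = r%:E.
  case E : i => [r| |]; first by exists r.
    by have := ilt _ Kx0; rewrite E ltNge leey.
  by move: mi; rewrite E.
have [||k hk] := @lsc_compact_gt phi K (fun k => r + k.+1%:R^-1)%R lphi cK.
- move=> p q pq; rewrite lerD2l lef_pV2 ?posrE// ler_nat ltnS//.
- move=> x /ilt; rewrite ir => /ereal_between[b rb bx].
  exists (Num.truncn (b - r)^-1); apply: le_lt_trans bx; rewrite lee_fin.
  rewrite -lerBrDl -[leRHS]invrK lef_pV2 ?posrE ?invr_gt0 ?subr_gt0//.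
  exact: ltW (truncnS_gt _).
have : (r + k.+1%:R^-1)%:E <= i.
  by apply: le_ereal_inf_tmp => _ [x Kx <-]; exact/ltW/hk.
by rewrite ir lee_fin gerDl leNgt invr_gt0 ltr0Sn.
Qed.

Lemma lscD_continuous phi (g : X -> R) : lower_semicontinuous phi ->
  continuous g -> lower_semicontinuous (fun x => phi x + (g x)%:E).
Proof.
move=> lphi cg x a; rewrite -lteBlDr// -EFinB => /ereal_between[b ab bx].
have [V Vx Vphi] := lphi _ _ bx.
have gx : (a - b < g x)%R by rewrite ltrBlDr -ltrBlDl.
exists (V `&` [set y | (a - b < g y)%R]).
  apply: filterI => //.
  exact: (cg x _ (lt_nbhsr gx)).
move=> y [/Vphi by_ /= gy]; rewrite -lteBlDr// (lt_trans _ by_)//.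
by rewrite -EFinB lte_fin ltrBlDr -ltrBlDl.
Qed.

End lsc.

(** * Affine minorants *)

Section dot_product.
Context (R : realType) (n : nat).
Implicit Types x y z : 'cV[R]_n.

Lemma dotpC x y : dotp x y = dotp y x.
Proof. by apply: eq_bigr => i _; rewrite mulrC. Qed.

Lemma dotpDl x y z : dotp (x + y)%R z = (dotp x z + dotp y z)%R.
Proof. by rewrite -big_split; apply: eq_bigr => i _; rewrite mxE mulrDl. Qed.

Lemma dotpZl (c : R) x y : dotp (c *: x)%R y = (c * dotp x y)%R.
Proof. by rewrite mulr_sumr; apply: eq_bigr => i _; rewrite mxE mulrA. Qed.

Lemma dotpBl x y z : dotp (x - y)%R z = (dotp x z - dotp y z)%R.
Proof. by rewrite dotpDl -scaleN1r dotpZl mulN1r. Qed.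

Lemma dotpDr x y z : dotp x (y + z)%R = (dotp x y + dotp x z)%R.
Proof. by rewrite ![dotp x _]dotpC dotpDl. Qed.

Lemma dotpBr x y z : dotp x (y - z)%R = (dotp x y - dotp x z)%R.
Proof. by rewrite ![dotp x _]dotpC dotpBl. Qed.

Lemma dotpZr (c : R) x y : dotp x (c *: y)%R = (c * dotp x y)%R.
Proof. by rewrite ![dotp x _]dotpC dotpZl. Qed.

Lemma dotp_sqrD (t : R) x y : dotp (x + t *: y)%R (x + t *: y)%R =
  (dotp x x + 2 * t * dotp x y + t ^+ 2 * dotp y y)%R.
Proof.
by rewrite dotpDl !dotpDr !dotpZl !dotpZr (dotpC y x); ring.
Qed.

Lemma dotp_ge0 x : (0 <= dotp x x)%R.
Proof. by apply: sumr_ge0 => i _; rewrite -expr2 sqr_ge0. Qed.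

Lemma norm_sqr_le_dotp x : (`|x| ^+ 2 <= dotp x x)%R.
Proof.
rewrite -[leRHS]sqr_sqrtr ?dotp_ge0// ler_sqr ?nnegrE ?sqrtr_ge0//.
apply/norm_leP; first exact: sqrtr_ge0.
move=> i; rewrite -sqrtr_sqr ler_wsqrtr// /dotp (bigD1 i)//= -expr2.
by rewrite lerDl sumr_ge0// => j _; rewrite -expr2 sqr_ge0.
Qed.

Lemma norm_le_enorm x : (`|x| <= enorm x)%R.
Proof.
rewrite -(ger0_norm (normr_ge0 x)) -sqrtr_sqr.
by rewrite ler_wsqrtr// norm_sqr_le_dotp.
Qed.

Lemma continuous_dotp_sub z : continuous (fun y => dotp (y - z) (y - z))%R.
Proof.
apply: continuous_big => [|i _]; first exact: add_continuous.
have ci : continuous (fun y : 'cV[R]_n => (y - z) i ord0)%R.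
  move=> y; under eq_fun do rewrite !mxE.
  by apply: continuousB; [exact: coord_continuous|exact: cst_continuous].
by move=> y; apply: continuousM; exact: ci.
Qed.

End dot_product.

Section affine_minorant.
Context (R : realType) (n : nat) (phi : 'cV[R]_n -> \bar R).
Hypothesis phiC : Conv_c phi.

(** Outside a cube coercivity gives the bound 0, and the cube is compact. *)
Lemma Conv_c_lbound : exists m : R, forall x, m%:E <= phi x.
Proof.
have [phiNy _ _ lphi cphi] := phiC.
have [r hr] := cphi 0%R.
have [m hm] := lsc_compact_lbound lphi (@compact_norm_le R n r) phiNy.
exists (Num.min m 0)%R => x; have [xr|rx] := leP `|x|%R r.
  by apply: le_trans (hm x xr); rewrite lee_fin ge_min lexx.
apply: le_trans (ltW (hr x (lt_le_trans rx (norm_le_enorm x)))).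
by rewrite lee_fin ge_min lexx orbT.
Qed.

(** Minimising [phi + k |. - z|^2] at some [y0]: the first order condition at
    [y0] is an affine minorant of [phi]. For large [k] its value at [z] exceeds
    [a]: either [y0] is close to [z], where [phi > a], or the penalty at [y0] is
    large. *)
Lemma affine_minorant (z : 'cV[R]_n) (a : R) : a%:E < phi z ->
  exists x : 'cV[R]_n, exists b : R,
    (forall y, (dotp x y - b)%:E <= phi y) /\ (a < dotp x z - b)%R.
Proof.
move=> az; have [phiNy vphi [y1 y1fin] lphi _] := phiC.
have [m hm] := Conv_c_lbound.
have [V Vz Va] := lphi _ _ az.
have [e e0 eV] := nbhs_normP Vz.
(* The penalty k * e ^+ 2 of a point at distance e from z exceeds a - m. *)
pose k := ((`|a - m| + 1) / e ^+ 2)%R.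
have e20 : (0 < e ^+ 2)%R by rewrite exprn_gt0.
have k0 : (0 < k)%R by rewrite divr_gt0// ltr_wpDl.
pose q y := dotp (y - z)%R (y - z)%R.
pose Q y := phi y + (k * q y)%:E.
have QNy y : -oo < Q y.
  by apply: lt_le_trans (leeD (hm y) (lexx _)); rewrite -EFinD ltNyr.
have lQ : lower_semicontinuous Q.
  apply: lscD_continuous => // y.
  apply: (@continuousM _ _ (fun=> k) q); first exact: cst_continuous.
  exact: continuous_dotp_sub.
have [v1 v1E] : exists v1, phi y1 = v1%:E.
  have := phiNy y1; case: (phi y1) y1fin => [v| |] //; by exists v.
pose d := (`|v1 + k * q y1 - m| / k + 1)%R.
have d1 : (1 <= d)%R by rewrite lerDr divr_ge0// ltW.
pose rho := (`|y1| + `|z| + d)%R.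
have y1rho : (`|y1| <= rho)%R.
  by rewrite /rho -addrA lerDl addr_ge0// (le_trans _ d1).
have [y0 _ y0min] : exists2 y0, True & forall y, Q y0 <= Q y.
  have [|y0 _ y0min] := lsc_compact_min lQ (@compact_norm_le R n rho) QNy.
    by exists y1.
  exists y0 => // y; have [yr|ry] := leP `|y|%R rho; first exact: y0min.
  apply: (@le_trans _ _ (Q y1)); first exact: y0min.
  apply: le_trans (leeD (hm y) (lexx _)); rewrite /Q v1E -!EFinD lee_fin.
  have dyz : (d <= `|y - z|)%R.
    rewrite (le_trans _ (lerB_normD _ _))// normrN lerBrDr; apply/ltW.
    apply: le_lt_trans ry; rewrite /rho addrC.
    by rewrite -[leLHS]add0r -addrA lerD2r.
  have qd : (d <= q y)%R.
    apply: le_trans (norm_sqr_le_dotp _); rewrite (le_trans dyz)// expr2.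
    by rewrite ler_peMl// (le_trans d1).
  have : (k * d <= k * q y)%R by rewrite ler_wpM2l// ltW.
  rewrite {1}/d mulrDr mulr1 [(k * (_ / k))%R]mulrC divfK ?gt_eqF//.
  by have := ler_norm (v1 + k * q y1 - m)%R; lra.
have [v0 v0E] : exists v0, phi y0 = v0%:E.
  have := y0min y1; have := phiNy y0; rewrite /Q v1E.
  by case: (phi y0) => [v| |] //; exists v.
pose x := (2 * k *: (z - y0))%R.
exists x, (dotp x y0 - v0)%R; split.
- move=> y; have := phiNy y; case vE : (phi y) => [v| |] // _;
    last by rewrite leey.
  rewrite lee_fin (_ : _ - _ = v0 + dotp x (y - y0))%R; last first.
    by rewrite dotpBr; ring.
  pose D := dotp (y - y0)%R (y - y0)%R.
  (* Compare y0 with the point at distance ratio t from y0 towards y, where t is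
     so small that the quadratic term k * D * t is at most eps. *)
  apply/ler_addgt0Pr => eps eps0.
  pose t := Num.min (1 / 2)%R (eps / (k * D + 1))%R.
  have D0 : (0 <= D)%R by exact: dotp_ge0.
  have kD0 : (0 <= k * D)%R by rewrite mulr_ge0// ltW.
  have t0 : (0 < t)%R by rewrite lt_min divr_gt0//= divr_gt0// ltr_wpDl.
  have t1 : (t < 1)%R by rewrite gt_min; apply/orP; left; lra.
  have te : (k * D * t <= eps)%R.
    have : (t <= eps / (k * D + 1))%R by rewrite ge_min lexx orbT.
    rewrite ler_pdivlMr ?ltr_wpDl// => h; rewrite mulrC (le_trans _ h)//.
    by rewrite ler_wpM2l// ?lerDl// ltW.
  have h1 := y0min (t *: y + (1 - t) *: y0)%R.
  have t01 : (0 < t < 1)%R by rewrite t0 t1.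
  have h2 := vphi y y0 t t01.
  have : Q y0 <= (t * v + (1 - t) * v0 + k * q (t *: y + (1 - t) *: y0))%:E.
    apply: (le_trans h1); rewrite /Q [in leRHS]EFinD leeD2r//.
    by apply: (le_trans h2); rewrite vE v0E -!EFinM -EFinD.
  rewrite /Q v0E -EFinD lee_fin.
  have -> : q (t *: y + (1 - t) *: y0)%R =
      (q y0 + 2 * t * dotp (y0 - z) (y - y0) + t ^+ 2 * D)%R.
    rewrite /q (_ : t *: y + (1 - t) *: y0 - z =
                    (y0 - z) + t *: (y - y0))%R; last first.
      by apply/matrixP => i j; rewrite !mxE; ring.
    by rewrite dotp_sqrD.
  have -> : dotp x (y - y0)%R = (- (2 * k) * dotp (y0 - z) (y - y0))%R.
    by rewrite /x dotpZl -(opprB y0 z) -scaleN1r dotpZl; ring.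
  set B := dotp (y0 - z)%R (y - y0)%R.
  move=> h.
  rewrite -(ler_pM2l t0).
  have : (t * (k * D * t) <= t * eps)%R by rewrite ler_wpM2l// ltW.
  by lra.
- rewrite (_ : _ - _ = v0 + dotp x (z - y0))%R; last by rewrite dotpBr; ring.
  rewrite /x dotpZl.
  rewrite (_ : dotp (z - y0) (z - y0) = q y0)%R; last first.
    by rewrite /q -(opprB y0 z) -scaleN1r dotpZl dotpZr; ring.
  have q0 : (0 <= q y0)%R by exact: dotp_ge0.
  have kq0 : (0 <= 2 * k * q y0)%R := mulr_ge0 (mulr_ge0 (ler0n _ 2) (ltW k0)) q0.
  have [yz|yz] := ltP `|y0 - z|%R e.
    have := Va _ (eV _ yz); rewrite v0E lte_fin; lra.
  have eq : (e ^+ 2 <= q y0)%R.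
    apply: le_trans (norm_sqr_le_dotp _); rewrite ler_sqr ?nnegrE//.
    exact: ltW.
  have : (k * e ^+ 2 <= k * q y0)%R by rewrite ler_wpM2l// ltW.
  rewrite {1}/k divfK ?gt_eqF// => h.
  have := hm y0; rewrite v0E lee_fin => mv.
  have := ler_norm (a - m)%R; lra.
Qed.

End affine_minorant.

(** * Measurability of lower semicontinuous functions *)

Section measurability.
Context (R : realType) (n : nat).

Lemma tnth_le_norm (t : n.-tuple R) i : (`|tnth t i| <= `|col_of_tuple t|)%R.
Proof. by have := coord_le_norm (col_of_tuple t) i; rewrite mxE. Qed.

Lemma measurable_preimage_ball (c : 'cV[R]_n) (e : R) : (0 < e)%R ->
  measurable [set t : n.-tuple R | (`|col_of_tuple t - c| < e)%R].
Proof.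
move=> e0; rewrite (_ : [set _ | _] = \bigcap_(i in [set: 'I_n])
    [set t | (`|tnth t i - c i ord0| < e)%R]); last first.
  apply/seteqP; split=> [t /(norm_ltP _ e0) h i _|t h].
    by have := h i; rewrite !mxE.
  by apply/(norm_ltP _ e0) => i; rewrite !mxE; exact: h.
apply: fin_bigcap_measurable => // i _; apply: measurable_setb.
apply: measurable_fun_ltr => //; apply: measurableT_comp => //.
apply: measurable_funB => //; exact: measurable_tnth.
Qed.

(** Every open set is a countable union of balls with rational centres and
    radii of the form 1 / (k + 1). *)
Lemma measurable_preimage_open (U : set 'cV[R]_n) : open U ->
  measurable (@col_of_tuple R n @^-1` U).
Proof.
move=> oU.
pose B (p : 'cV[rat]_n * nat) :=
  [set x : 'cV[R]_n | (`|x - map_mx ratr p.1| < p.2.+1%:R^-1)%R].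
pose F p := if `[< B p `<=` U >] then @col_of_tuple R n @^-1` (B p) else set0.
rewrite (_ : _ @^-1` U = \bigcup_p F p); last first.
  apply/seteqP; split=> [t Ut|t [p _]]; last first.
    by rewrite /F; case: asboolP => // pU; exact: pU.
  have [e e0 eU] := nbhs_normP (oU _ Ut).
  pose k := Num.truncn (2 / e)%R; pose d : R := (k.+1%:R^-1)%R.
  have d0 : (0 < d)%R by rewrite invr_gt0.
  have de : (d + d <= e)%R.
    have : (2 / e < k.+1%:R)%R by exact: truncnS_gt.
    rewrite ltr_pdivrMr// => h.
    have : (d * 2 <= d * (k.+1%:R * e))%R by rewrite ler_wpM2l// ltW.
    by rewrite mulrA mulVf// mul1r; lra.
  have /choice[c hc] (i : 'I_n) : exists c : rat, (`|tnth t i - ratr c| < d)%R.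
    have [|c] := @rat_in_itvoo R (tnth t i - d)%R (tnth t i + d)%R; first lra.
    rewrite in_itv/= => /andP[h1 h2]; exists c; rewrite ltr_norml; lra.
  exists (\col_i c i, k) => //; rewrite /F.
  have tB : (`|col_of_tuple t - map_mx ratr (\col_i c i)| < d)%R.
    by apply/(norm_ltP _ d0) => i; rewrite !mxE.
  case: asboolP => [_|[]]; first exact: tB.
  move=> x /= xB; apply: eU.
  rewrite -(subrKA (map_mx ratr (\col_i c i))) (le_lt_trans (ler_normD _ _))//.
  by rewrite (lt_le_trans _ de)// ltrD// distrC.
apply: countable_bigcupT_measurable; first exact: countableP.
move=> p; rewrite /F; case: asboolP => // _.
by apply: measurable_preimage_ball; rewrite invr_gt0.
Qed.

Lemma measurable_lsc (phi : 'cV[R]_n -> \bar R) : lower_semicontinuous phi ->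
  measurable_fun [set: n.-tuple R] (phi \o @col_of_tuple R n).
Proof.
move=> /lower_semicontinuousP lphi.
apply: (measurability _ (ErealGenOInfty.measurableE R)).
move=> /= _ [_ [a ->]] <-; apply: measurableI => //.
rewrite comp_preimage preimage_itvoy.
exact: measurable_preimage_open (lphi a).
Qed.

Lemma expN_ge0 (phi : 'cV[R]_n -> \bar R) x : (0 <= expN phi x)%R.
Proof. by rewrite /expN fine_ge0// expeR_ge0. Qed.

Lemma expN_fin (phi : 'cV[R]_n -> \bar R) x v : phi x = v%:E ->
  expN phi x = expR (- v).
Proof. by rewrite /expN => ->. Qed.

Lemma expN_y (phi : 'cV[R]_n -> \bar R) x : phi x = +oo -> expN phi x = 0%R.
Proof. by rewrite /expN => ->. Qed.

(** Turns the sublevel sets of [expN phi] into superlevel sets of [phi]. *)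
Lemma expN_lt (phi : 'cV[R]_n -> \bar R) x (c : R) : -oo < phi x ->
  (0 < c)%R -> (expN phi x < c)%R = ((- ln c)%:E < phi x).
Proof.
case E : (phi x) => [v| |] // _ c0.
  by rewrite (expN_fin E) lte_fin -{1}(@lnK _ c) ?posrE// ltr_expR ltrNl.
by rewrite (expN_y E) c0 ltry.
Qed.

Lemma expN_le (phi : 'cV[R]_n -> \bar R) x (m : R) : m%:E <= phi x ->
  (expN phi x <= expR (- m))%R.
Proof.
case E : (phi x) => [v| |] // mv; last by rewrite (expN_y E) expR_ge0.
by rewrite (expN_fin E) ler_expR lerN2 -lee_fin.
Qed.

Lemma expN_anti (phi1 phi2 : 'cV[R]_n -> \bar R) x y : -oo < phi1 x ->
  phi1 x <= phi2 y -> (expN phi2 y <= expN phi1 x)%R.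
Proof.
case E1 : (phi1 x) => [u| |] // _; last first.
  by rewrite leye_eq => /eqP E2; rewrite (expN_y E2) expN_ge0.
by move=> /expN_le; rewrite (expN_fin E1).
Qed.

Lemma measurable_expN (phi : 'cV[R]_n -> \bar R) : (forall x, -oo < phi x) ->
  lower_semicontinuous phi ->
  measurable_fun [set: n.-tuple R] (expN phi \o @col_of_tuple R n).
Proof.
move=> phiNy /measurable_lsc mphi.
apply: (measurability _ (RGenInftyO.measurableE R)).
move=> /= _ [_ [c ->]] <-; apply: measurableI => //.
have [c0|c0] := leP c 0%R.
  rewrite (_ : _ @^-1` _ = set0)//; apply/seteqP; split => // t /=.
  by rewrite in_itv/= ltNge (le_trans c0)// expN_ge0.
rewrite (_ : _ @^-1` _ = [set t | (- ln c)%:E < (phi \o @col_of_tuple R n) t]).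
  apply: measurable_setb; exact: measurable_fun_lte.
by apply/seteqP; split=> t /=; rewrite in_itv/= expN_lt.
Qed.

End measurability.

(** * Thickening a function *)

(** On [expN phi] this is the truncation to a cube, which makes the integrals
    finite. *)
Definition confine (R : realType) (n : nat) (r : R) (phi : 'cV[R]_n -> \bar R)
  (x : 'cV[R]_n) : \bar R := if (`|x| <= r)%R then phi x else +oo.

(** The infimal convolution of [phi] with the indicator of a cube of side
    [2 * e]; on [expN phi] it takes the supremum over that cube. *)
Definition thicken (R : realType) (n : nat) (e : R) (phi : 'cV[R]_n -> \bar R)
    (x : 'cV[R]_n) : \bar R :=
  ereal_inf [set phi y | y in [set y | `|y - x| <= e]%R].

Section confine_thicken.
Context (R : realType) (n : nat).
Implicit Types phi : 'cV[R]_n -> \bar R.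

Lemma confine_ge phi (r : R) x : phi x <= confine r phi x.
Proof. by rewrite /confine; case: ifP => // _; rewrite leey. Qed.

Lemma confine_anti phi (r s : R) x : (r <= s)%R ->
  confine s phi x <= confine r phi x.
Proof.
move=> rs; rewrite /confine; case: (leP `|x|%R r) => [xr|_];
  last by rewrite leey.
by rewrite (le_trans xr rs).
Qed.

Lemma lsc_confine phi (r : R) : lower_semicontinuous phi ->
  lower_semicontinuous (confine r phi).
Proof.
move=> lphi x a; rewrite {1}/confine; case: ifPn => [xr ax|].
  have [V Vx Va] := lphi _ _ ax.
  by exists V => // y /Va /lt_le_trans; apply; exact: confine_ge.
rewrite -ltNge => rx _; exists [set y | (`|y - x| < `|x| - r)%R].
  by apply: (norm_nbhs (e := `|x| - r)%R) => //; rewrite subr_gt0.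
move=> y /= yx; rewrite /confine ifF ?ltry//; apply/negbTE; rewrite -ltNge.
have : (`|x| <= `|y| + `|y - x|)%R.
  by rewrite -[X in (`|X| <= _)%R](subrK y) addrC (distrC y) ler_normD.
by lra.
Qed.

Lemma thicken_le phi (e : R) x y : (`|y - x| <= e)%R -> thicken e phi x <= phi y.
Proof. by move=> yx; apply: ereal_inf_lbound; exists y. Qed.

Lemma thicken_ge phi (e : R) x b :
  (forall y, (`|y - x| <= e)%R -> b <= phi y) -> b <= thicken e phi x.
Proof. by move=> h; apply: le_ereal_inf_tmp => _ [y /= yx <-]; exact: h. Qed.

(** If [phi > b] at all points within [e] of [x], then also on a neighbourhood of
    that compact set, and so at all points within [e] of any [x'] near [x]. *)
Lemma lsc_thicken phi (e : R) : lower_semicontinuous phi ->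
  lower_semicontinuous (thicken e phi).
Proof.
move=> lphi x a /ereal_between[b ab bx].
pose K := [set y : 'cV[R]_n | (`|y| <= `|x| + 1 + e)%R].
have /compact_near_coveringP cK : compact K by exact: compact_norm_le.
have Kb : \forall x' \near x,
    K `<=` (fun y => (`|y - x'| <= e)%R -> b%:E < phi y).
  apply: (cK _ (nbhs x) (fun x' y => (`|y - x'| <= e)%R -> b%:E < phi y)) => y Ky.
  have [yx|yx] := leP `|y - x|%R e.
    have [V Vy Vb] := lphi _ _ (lt_le_trans bx (thicken_le phi yx)).
    exists (V, setT); first by split => //; exact: filterT.
    by move=> [y' x'] [/= /Vb].
  pose d := ((`|y - x| - e) / 2)%R.
  have d0 : (0 < d)%R by rewrite divr_gt0// subr_gt0.
  exists ([set y' | `|y' - y| < d]%R, [set x' | `|x' - x| < d]%R).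
    by split; exact: (norm_nbhs d0).
  move=> [y' x'] [/= y'y x'x] yx'; exfalso.
  have : (`|y - x| <= `|y' - y| + `|y' - x'| + `|x' - x|)%R.
    rewrite (_ : y - x = - (y' - y) + (y' - x') + (x' - x))%R; last first.
      by apply/matrixP => i j; rewrite !mxE; ring.
    apply: (le_trans (ler_normD _ _)); rewrite lerD2r.
    by apply: (le_trans (ler_normD _ _)); rewrite normrN.
  by rewrite /d in y'y x'x; lra.
exists [set x' | K `<=` (fun y => (`|y - x'| <= e)%R -> b%:E < phi y) /\
    (`|x' - x| < 1)%R].
  by apply: filterI => //; exact: (norm_nbhs ltr01).
move=> x' [Kx' x'x]; apply: (@lt_le_trans _ _ b%:E); first by rewrite lte_fin.
apply: thicken_ge => y yx'; apply/ltW/Kx' => //; rewrite /K/=.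
have : (`|y| <= `|x| + `|x' - x| + `|y - x'|)%R.
  rewrite (_ : `|y| = `|x + (x' - x) + (y - x')|)%R; last first.
    by congr (`| _ |)%R; apply/matrixP => i j; rewrite !mxE; ring.
  apply: (le_trans (ler_normD _ _)); rewrite lerD2r.
  exact: ler_normD.
by lra.
Qed.

Lemma thicken_gtNy phi (e : R) x (m : R) : (forall y, m%:E <= phi y) ->
  -oo < thicken e phi x.
Proof.
by move=> h; apply: lt_le_trans (thicken_ge (fun y _ => h y)); rewrite ltNyr.
Qed.

(** Lower semicontinuity makes the infimum over a shrinking ball converge to the
    value at the centre. *)
Lemma expN_thicken_cvg phi x (m : R) : lower_semicontinuous phi ->
  (forall y, m%:E <= phi y) ->
  expN (thicken k.+1%:R^-1%R phi) x @[k --> \oo] --> expN phi x.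
Proof.
move=> lphi hm; apply/cvgrPdist_lt => eps eps0.
have phiNy y : -oo < phi y by apply: lt_le_trans (hm y); rewrite ltNyr.
have hc : (0 < expN phi x + eps)%R by rewrite ltr_wpDl ?expN_ge0.
have : (expN phi x < expN phi x + eps)%R by rewrite ltrDl.
rewrite expN_lt// => h; have [b ab bx] := ereal_between h.
have [V Vx Vb] := lphi _ _ bx; have [d d0 dV] := nbhs_normP Vx.
exists (Num.truncn d^-1%R) => // k /= dk.
have kd : (k.+1%:R^-1 < d)%R.
  rewrite -[ltRHS]invrK ltf_pV2 ?posrE ?invr_gt0//.
  by apply: lt_le_trans (truncnS_gt _) _; rewrite ler_nat ltnS.
rewrite ler0_norm ?opprB; last first.
  rewrite subr_le0; apply: expN_anti; first exact: (thicken_gtNy _ _ hm).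
  by apply: thicken_le; rewrite subrr normr0 invr_ge0.
rewrite ltrBlDl expN_lt//; last exact: (thicken_gtNy _ _ hm).
apply: (@lt_le_trans _ _ b%:E); first by rewrite lte_fin.
apply: thicken_ge => y yx; apply/ltW/Vb/dV; exact: le_lt_trans kd.
Qed.

(** All these functions vanish off the cube of radius [r + 1] and are at most
    [expR (- m)], so dominated convergence applies. *)
Lemma integral_thicken_cvg phi (m r : R) : lower_semicontinuous phi ->
  (forall y, m%:E <= phi y) -> (forall y, (r < `|y|)%R -> phi y = +oo) ->
  \int[lebn R n]_t (expN (thicken k.+1%:R^-1%R phi) (col_of_tuple t))%:E
    @[k --> \oo] --> \int[lebn R n]_t (expN phi (col_of_tuple t))%:E.
Proof.
move=> lphi hm phir.
have phiNy y : -oo < phi y by apply: lt_le_trans (hm y); rewrite ltNyr.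
pose C := (cube n (r + 1)%R).
have mC : measurable C by exact: measurable_cube.
pose g (t : n.-tuple R) := (expR (- m) * \1_C t)%:E.
have ig : (lebn R n).-integrable setT g.
  rewrite /g; under eq_fun do rewrite EFinM.
  apply: integrableZl => //; apply/integrableP; split.
    by apply/measurable_EFinP; exact: measurable_indic.
  under eq_integral do rewrite gee0_abs ?lee_fin//.
  by rewrite integral_indic// setIT; exact: lebesgue_n_cube.
have [] := @dominated_convergence _ _ _ (lebn R n) setT measurableT
  (fun k t => (expN (thicken k.+1%:R^-1%R phi) (col_of_tuple t))%:E)
  (fun t => (expN phi (col_of_tuple t))%:E) g _ _ _ ig _ => //.
- move=> k; apply/measurable_EFinP; apply: measurable_expN.
    by move=> x; exact: (thicken_gtNy _ _ hm).
  exact: lsc_thicken.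
- by apply/measurable_EFinP; exact: measurable_expN.
- apply: aeW => t _; apply: cvg_EFin; first exact: nearW.
  exact: (expN_thicken_cvg lphi hm).
- apply: aeW => t k _; rewrite /g gee0_abs ?lee_fin ?expN_ge0//.
  have [tC|tC] := pselect (C t).
    rewrite indicE mem_set// mulr1; apply: expN_le; apply: thicken_ge => y _.
    exact: hm.
  rewrite indicE memNset// mulr0 expN_y//; apply/eqP; rewrite -leye_eq.
  apply: thicken_ge => y yt; rewrite phir ?leey// ltNge; apply/negP => yr.
  apply: tC => i; apply: le_trans (tnth_le_norm t i) _.
  rewrite -(subrK y (col_of_tuple t)) addrC (le_trans (ler_normD _ _))//.
  rewrite lerD// distrC (le_trans yt)//.
  by rewrite invf_le1// ler1n.
Qed.

End confine_thicken.

(** * Comparing integrals through averages *)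

Lemma mulmx_norm_le (R : realType) (n : nat) (A : 'M[R]_n) (z : 'cV[R]_n) :
  (`|A *m z| <= n%:R * `|A| * `|z|)%R.
Proof.
apply/norm_leP; first by rewrite !mulr_ge0.
move=> i; rewrite mxE (le_trans (ler_norm_sum _ _ _))//.
apply: (@le_trans _ _ (\sum_(j < n) `|A| * `|z|)%R); last first.
  by rewrite sumr_const card_ord -mulrA mulr_natl.
apply: ler_sum => j _; rewrite normrM ler_pM//; last exact: coord_le_norm.
by rewrite [leRHS]mx_normrE; apply/bigmax_geP; right; exists (i, j).
Qed.

Lemma expN_ge (R : realType) (n : nat) (phi : 'cV[R]_n -> \bar R) x (v : R) :
  -oo < phi x -> phi x <= v%:E -> (expR (- v) <= expN phi x)%R.
Proof.
case E : (phi x) => [u| |] // _; rewrite lee_fin => uv.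
by rewrite (expN_fin E) ler_expR lerN2.
Qed.

Lemma expN_gt0 (R : realType) (n : nat) (phi : 'cV[R]_n -> \bar R) x :
  (0 < expN phi x)%R -> exists c, phi x = c%:E.
Proof.
case E : (phi x) => [u| |] //; first by exists u.
  by rewrite (expN_y E) ltxx.
by rewrite /expN E /= ltxx.
Qed.

Lemma lebn_finite_cube (R : realType) (n : nat) (f : n.-tuple R -> R)
    (M rho : R) : measurable_fun [set: n.-tuple R] f ->
  (forall t, 0 <= f t <= M)%R -> (forall t, 0 < f t -> cube n rho t)%R ->
  exists2 K : R, \int[lebn R n]_t (f t)%:E = K%:E & (0 <= K)%R.
Proof.
move=> mf f0M fc.
have I0 : 0 <= \int[lebn R n]_t (f t)%:E.
  by apply: integral_ge0 => t _; rewrite lee_fin; have /andP[] := f0M t.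
exists (fine (\int[lebn R n]_t (f t)%:E)); last exact: fine_ge0.
rewrite fineK// ge0_fin_numE//.
apply: (@le_lt_trans _ _ (M%:E * lebn R n (cube n rho))).
  apply: ge0_integral_le_cube => [|t|t]; first exact/measurable_EFinP.
    by rewrite !lee_fin.
  by rewrite lte_fin; exact: fc.
rewrite lte_mul_pinfty//; last exact: lebesgue_n_cube.
have /andP[h1 h2] := f0M [tuple 0%R | _ < n].
by rewrite lee_fin (le_trans h1 h2).
Qed.

Section averages.
Context (R : realType) (n : nat) (psi phi : 'cV[R]_n -> \bar R).
Hypothesis psiNy : forall x, -oo < psi x.
Hypothesis lpsi : lower_semicontinuous psi.
Context (m : R).
Hypothesis phim : forall x, m%:E <= phi x.
Hypothesis lphi : lower_semicontinuous phi.

(** The inequality that a mean of the functions [psi o A i ^-1], in the sense of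
    infimal convolution, satisfies exactly. It is only required for points of a
    cube and up to a displacement [e], because a finite family [A] can only
    approximate an integral over rotations. *)
Definition below_averages (r e : R) :=
  exists (I : finType) (w : I -> R) (A : I -> 'M[R]_n),
  [/\ forall i, (0 <= w i)%R, (\sum_i w i = 1)%R,
      forall i, (`|\det (A i)| = 1)%R &
    forall (z : I -> 'cV[R]_n) (c : I -> R),
    (forall i, `|z i| <= r)%R -> (forall i, psi (z i) = (c i)%:E) ->
    exists y : 'cV[R]_n,
    [/\ (`|y| <= n%:R * r)%R, (`|y - \sum_i w i *: (A i *m z i)| <= e)%R &
        phi y <= (\sum_i w i * c i)%:E]].

(** The Prekopa-Leindler inequality for the functions
    [expN (confine r psi) o A i ^-1]: they have equal integrals [K], so their
    weighted geometric mean is [K] as well. The displacement [e] is absorbed by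
    thickening. *)
Lemma integral_confine_le (r e : R) : below_averages r e ->
  \int[lebn R n]_t (expN (confine r psi) (col_of_tuple t))%:E <=
  \int[lebn R n]_t
    (expN (thicken e (confine (n%:R * r) phi)) (col_of_tuple t))%:E.
Proof.
move=> [I [w [A [w0 w1 detA avg]]]].
pose g (t : n.-tuple R) := expN (confine r psi) (col_of_tuple t).
have cNy x : -oo < confine r psi x by exact: lt_le_trans (confine_ge _ _ _).
have mg : measurable_fun [set: n.-tuple R] g.
  by apply: measurable_expN => //; exact: lsc_confine.
have [m' hm'] := lsc_compact_lbound lpsi (@compact_norm_le R n r) psiNy.
have gM t : (0 <= g t <= expR (- m'))%R.
  rewrite expN_ge0/=; apply: expN_le; rewrite /confine.
  by case: ifPn => [tr|_]; [exact: hm'|rewrite leey].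
have gc x : (0 < expN (confine r psi) x)%R ->
    (`|x| <= r)%R /\ exists c, psi x = c%:E.
  move=> /expN_gt0[c]; rewrite /confine; case: ifP => // _ E.
  by split => //; exists c.
have [|K KE] := @lebn_finite_cube _ _ g _ r mg gM.
  move=> t /gc[tr _] i; exact: le_trans (tnth_le_norm t i) tr.
rewrite KE le_eqVlt => /predU1P[<-|K0].
  by apply: integral_ge0 => t _; rewrite lee_fin expN_ge0.
have uA i : A i \in unitmx.
  by rewrite unitmxE unitfE -normr_gt0 detA.
pose F i t := g (tmul (invmx (A i)) t).
pose rho := (\sum_i n%:R * `|A i| * `|r|)%R.
have tNy x : -oo < thicken e (confine (n%:R * r)%R phi) x.
  apply: (@thicken_gtNy _ _ _ _ _ m) => y.
  exact: le_trans (phim y) (confine_ge _ _ _).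
have lt : lower_semicontinuous (thicken e (confine (n%:R * r)%R phi)).
  by apply: lsc_thicken; exact: lsc_confine.
rewrite (_ : K = expR (\sum_i w i * ln K)%R); last first.
  by rewrite -mulr_suml w1 mul1r lnK.
apply: (@prekopa_leindler _ _ _ _ F _ (expR (- m')) rho) => //.
- by move=> i; apply: measurableT_comp => //; exact: measurable_tmul.
- by move=> i t; exact: gM.
- move=> i t; rewrite /F /g => /gc[+ _].
  rewrite /tmul tuple_of_colK; set z := (invmx (A i) *m _)%R => zr j.
  have -> : tnth t j = (A i *m z)%R j ord0 by rewrite mulKVmx// mxE.
  rewrite (le_trans (coord_le_norm _ _))// (le_trans (mulmx_norm_le _ _))//.
  rewrite /rho (bigD1 i)//= ler_wpDr//.
    by apply: sumr_ge0 => l _; rewrite !mulr_ge0.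
  by rewrite ler_wpM2l ?mulr_ge0// (le_trans zr)// ler_norm.
- by apply/measurable_EFinP; exact: measurable_expN.
- by move=> t; rewrite lee_fin expN_ge0.
- move=> y Fy.
  pose z i := (invmx (A i) *m col_of_tuple (y i))%R.
  have Fz i : (0 < expN (confine r psi) (z i))%R.
    by have := Fy i; rewrite /F /g /tmul tuple_of_colK.
  have /choice[c hc] i : exists c, psi (z i) = c%:E by have [] := gc _ (Fz i).
  have zr i : (`|z i| <= r)%R by have [] := gc _ (Fz i).
  have [y' [y'r y'e y'c]] := avg z c zr hc.
  have -> : (\sum_i w i * ln (F i (y i)) = - (\sum_i w i * c i))%R.
    rewrite -sumrN; apply: eq_bigr => i _.
    rewrite /F /g /tmul tuple_of_colK (@expN_fin _ _ _ _ (c i)).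
      by rewrite expRK mulrN.
    by rewrite -/(z i) /confine zr hc.
  rewrite lee_fin; apply: expN_ge => //; apply: le_trans y'c.
  rewrite (_ : phi y' = confine (n%:R * r)%R phi y'); last first.
    by rewrite /confine y'r.
  apply: thicken_le; rewrite (_ : col_of_tuple _ = \sum_i w i *: (A i *m z i))%R//.
  apply/matrixP => j k; rewrite mxE tnth_mktuple summxE; apply: eq_bigr => i _.
  by rewrite /z mulKVmx// !mxE.
- move=> i; rewrite -KE -[RHS](@scales_lebn_unit _ _ (invmx (A i)))//.
  + by rewrite det_inv normfV detA invr1 mul1e.
  + by rewrite unitmx_inv.
  + exact/measurable_EFinP.
  + by move=> t; rewrite lee_fin expN_ge0.
Qed.

(** First the displacement tends to 0 for a fixed cube, then the cube grows. *)
Theorem J_le_of_averages :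
  (forall r k, (0 <= r)%R -> below_averages r k.+1%:R^-1%R) ->
  J (expN psi) <= J (expN phi).
Proof.
move=> avg.
have mpsi := measurable_expN psiNy lpsi.
have phiNy x : -oo < phi x by apply: lt_le_trans (phim x); rewrite ltNyr.
have conf r : (0 <= r)%R ->
    \int[lebn R n]_t (expN (confine r psi) (col_of_tuple t))%:E <= J (expN phi).
  move=> r0; pose phir := confine (n%:R * r)%R phi.
  have phirm y : m%:E <= phir y by exact: le_trans (phim y) (confine_ge _ _ _).
  have lphir : lower_semicontinuous phir by exact: lsc_confine.
  apply: (@le_trans _ _ (\int[lebn R n]_t (expN phir (col_of_tuple t))%:E)).
    have phiry y : (n%:R * r < `|y|)%R -> phir y = +oo.
      by move=> yr; rewrite /phir /confine leNgt yr.
    have cv := integral_thicken_cvg lphir phirm phiry.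
    rewrite -(cvg_lim _ cv)//; apply: lime_ge.
      by apply/cvg_ex; eexists; exact: cv.
    by apply: nearW => k; exact: integral_confine_le (avg r k r0).
  apply: ge0_le_integral => //.
  - by move=> t _; rewrite lee_fin expN_ge0.
  - apply/measurable_EFinP; apply: measurable_expN => // y.
    exact: lt_le_trans (phiNy y) (confine_ge _ _ _).
  - by apply/measurable_EFinP; exact: measurable_expN.
  - by move=> t _; rewrite lee_fin expN_anti// confine_ge.
have cNy r x : -oo < confine r psi x by exact: lt_le_trans (confine_ge _ _ _).
pose u k (t : n.-tuple R) := (expN (confine k%:R psi) (col_of_tuple t))%:E.
rewrite /J (_ : (fun t => _) = (fun t => limn (u ^~ t))); last first.
  apply/funext => t; apply/esym/cvg_lim => //; apply: cvg_near_cst.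
  exists (Num.truncn `|col_of_tuple t|%R).+1 => // k /= tk.
  rewrite /u /expN /confine ifT// (le_trans (ltW (truncnS_gt _)))// ler_nat//.
rewrite [leLHS](@monotone_convergence _ _ _ (lebn R n) _ measurableT u); first last.
- by move=> t _ k l kl; rewrite lee_fin expN_anti// confine_anti// ler_nat.
- by move=> k t _; rewrite lee_fin expN_ge0.
- move=> k; apply/measurable_EFinP; apply: measurable_expN => //.
  exact: lsc_confine.
apply: lime_le; last by apply: nearW => k; exact: conf.
apply: ereal_nondecreasing_is_cvgn => k l kl; apply: ge0_le_integral => //.
- by move=> t _; rewrite lee_fin expN_ge0.
- by apply/measurable_EFinP; apply: measurable_expN => //; exact: lsc_confine.
- by apply/measurable_EFinP; apply: measurable_expN => //; exact: lsc_confine.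
by move=> t _; rewrite lee_fin expN_anti// confine_anti// ler_nat.
Qed.

End averages.

(** * Bounded functions and Borel measurability on matrices *)

Section bounded_expectation.
Context d (T : measurableType d) (R : realType) (mu : probability T R).
Context (D : set T) (mD : measurable D).

Definition bounded_mfun (f : T -> R) :=
  measurable_fun [set: T] f /\ exists C, forall x, D x -> (`|f x| <= C)%R.

Lemma bounded_mfun_integrable f : bounded_mfun f ->
  mu.-integrable D (EFin \o f).
Proof.
move=> [mf [C fC]]; apply: measurable_bounded_integrable => //.
- by rewrite -ge0_fin_numE// fin_num_measure.
- exact: measurable_funTS.
- exists C; split; first exact: num_real.
  by move=> x Cx y /fC/le_trans; apply; exact: ltW.
Qed.

Lemma bounded_mfun_cst c : bounded_mfun (fun=> c).
Proof. by split => //; exists `|c|%R. Qed.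

Lemma bounded_mfunM f g : bounded_mfun f -> bounded_mfun g ->
  bounded_mfun (fun x => f x * g x)%R.
Proof.
move=> [mf [C fC]] [mg [C' gC]]; split; first exact: measurable_funM.
by exists (C * C')%R => x Dx; rewrite normrM ler_pM// ?fC ?gC.
Qed.

Lemma bounded_mfunB f g : bounded_mfun f -> bounded_mfun g ->
  bounded_mfun (fun x => f x - g x)%R.
Proof.
move=> [mf [C fC]] [mg [C' gC]]; split; first exact: measurable_funB.
exists (C + C')%R => x Dx; rewrite (le_trans (ler_normB _ _))//.
by rewrite lerD ?fC ?gC.
Qed.

Lemma bounded_mfun_norm f : bounded_mfun f ->
  bounded_mfun (fun x => `|f x|)%R.
Proof.
move=> [mf [C fC]]; split; first exact: measurableT_comp.
by exists C => x Dx; rewrite normr_id; exact: fC.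
Qed.

Lemma bounded_mfun_sum (I : Type) (s : seq I) (f : I -> T -> R) :
  (forall i, bounded_mfun (f i)) -> bounded_mfun (fun x => \sum_(i <- s) f i x)%R.
Proof.
move=> bf; split; first by apply: measurable_sum => i; have [] := bf i.
have /choice[C hC] i : exists C, forall x, D x -> (`|f i x| <= C)%R.
  by have [] := bf i.
exists (\sum_(i <- s) C i)%R => x Dx; rewrite (le_trans (ler_norm_sum _ _ _))//.
by apply: ler_sum => i _; exact: hC.
Qed.

Lemma bounded_mfun_indic B : measurable B -> bounded_mfun (\1_B : T -> R).
Proof.
move=> mB; split; first exact: measurable_indic.
by exists 1%R => x _; rewrite indicE; case: (_ \in _); rewrite ?normr1 ?normr0.
Qed.

Lemma Rintegral_sum (I : Type) (s : seq I) (f : I -> T -> R) :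
  (forall i, bounded_mfun (f i)) ->
  (\int[mu]_(x in D) (\sum_(i <- s) f i x) =
   \sum_(i <- s) \int[mu]_(x in D) f i x)%R.
Proof.
move=> bf; elim: s => [|i s IH].
  rewrite big_nil; under eq_Rintegral do rewrite big_nil.
  by rewrite Rintegral_cst// mul0r.
rewrite big_cons -IH -RintegralD//; last 2 first.
- exact: bounded_mfun_integrable.
- by apply: bounded_mfun_integrable; exact: bounded_mfun_sum.
by apply: eq_Rintegral => x _; rewrite big_cons.
Qed.

(** As [h] may fail to be integrable, positive and negative parts are compared
    separately. *)
Lemma Rintegral_le_integral (f : T -> R) (h : T -> \bar R) : bounded_mfun f ->
  measurable_fun D h -> (forall x, D x -> (f x)%:E <= h x) ->
  (\int[mu]_(x in D) f x)%R%:E <= \int[mu]_(x in D) h x.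
Proof.
move=> bf mh fh; have mf : measurable_fun D (EFin \o f).
  by apply/measurable_EFinP; apply: measurable_funTS; case: bf.
rewrite /Rintegral fineK; last first.
  exact: (integrable_fin_num mD (bounded_mfun_integrable bf)).
rewrite integralE [leRHS]integralE; apply: leeB.
  apply: ge0_le_integral => //.
  - exact: measurable_funepos.
  - exact: measurable_funepos.
  - move=> x Dx; apply: (@funepos_le _ _ D) => //; [move=> y|]; rewrite inE//.
    exact: fh.
apply: ge0_le_integral => //.
- exact: measurable_funeneg.
- exact: measurable_funeneg.
- move=> x Dx; apply: (@funeneg_le _ _ D) => //; [move=> y|]; rewrite inE//.
  exact: fh.
Qed.

End bounded_expectation.

Section matrix_borel.
Context (R : realType) (n : nat).

Lemma continuous_measurable_mx (f : 'M[R]_n -> R) : continuous f ->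
  measurable_fun [set: mxborel R n] (f : mxborel R n -> R).
Proof.
move=> /continuousP cf; apply: (measurability _ (RGenOpens.measurableE R)).
move=> _ [_ [a [b ->] <-]]; rewrite setTI; apply: sub_sigma_algebra.
by apply: cf; exact: interval_open.
Qed.

Lemma lsc_measurable_mx (f : 'M[R]_n -> \bar R) : lower_semicontinuous f ->
  measurable_fun [set: mxborel R n] (f : mxborel R n -> \bar R).
Proof.
move=> /lower_semicontinuousP lf.
apply: (measurability _ (ErealGenOInfty.measurableE R)).
move=> /= _ [_ [a ->]] <-; rewrite setTI; apply: sub_sigma_algebra.
by rewrite preimage_itvoy; exact: lf.
Qed.

Lemma continuous_mulmx_entry (x : 'cV[R]_n) i :
  continuous (fun A : 'M[R]_n => (A *m x)%R i ord0).
Proof.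
rewrite (_ : (fun A => _) =
    fun A : 'M[R]_n => (\sum_(j < n) A i j * x j ord0)%R); last first.
  by apply/funext => A; rewrite mxE.
apply: continuous_big => [|j _]; first exact: add_continuous.
move=> A; apply: continuousM; last exact: cst_continuous.
exact: coord_continuous.
Qed.

Lemma continuous_dotp_mulmx (x y : 'cV[R]_n) :
  continuous (fun A : 'M[R]_n => dotp x (A *m y)%R).
Proof.
apply: continuous_big => [|j _]; first exact: add_continuous.
move=> A; apply: continuousM; first exact: cst_continuous.
exact: continuous_mulmx_entry.
Qed.

Lemma dotp_trmx (A : 'M[R]_n) (x y : 'cV[R]_n) :
  dotp (A^T *m x)%R y = dotp x (A *m y)%R.
Proof.
rewrite /dotp; under eq_bigr do rewrite mxE mulr_suml.
rewrite exchange_big/=; apply: eq_bigr => i _; rewrite mxE mulr_sumr.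
by apply: eq_bigr => j _; rewrite mxE; ring.
Qed.

Lemma measurable_SO : measurable (@SO R n : set (mxborel R n)).
Proof.
rewrite (_ : @SO R n = \bigcap_(p in [set: 'I_n * 'I_n])
    [set A : mxborel R n | (A *m A^T) p.1 p.2 == 1%:M%R p.1 p.2 :> R] `&`
    [set A : mxborel R n | \det (A : 'M[R]_n) == 1%R])%R; last first.
  apply/seteqP; split=> [A [AA dA]|A [AA /eqP dA]].
    by split; [move=> p _ /=; rewrite AA|rewrite /= dA].
  split => //; apply/matrixP => i j; apply/eqP; exact: (AA (i, j)).
apply: measurableI.
  apply: fin_bigcap_measurable => // -[i j] _ /=; apply: measurable_setb.
  apply: measurable_fun_eqr => //; apply: continuous_measurable_mx.
  rewrite (_ : (fun _ => _) =
      fun A : 'M[R]_n => (\sum_(k < n) A i k * A j k)%R); last first.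
    by apply/funext => A; rewrite mxE; apply: eq_bigr => k _; rewrite mxE.
  apply: continuous_big => [|k _]; first exact: add_continuous.
  by move=> A; apply: continuousM; exact: coord_continuous.
apply: measurable_setb; apply: measurable_fun_eqr => //.
apply: continuous_measurable_mx.
apply: continuous_big => [|s _]; first exact: add_continuous.
have cM (c : R) (g : 'M[R]_n -> R) :
    continuous g -> continuous (fun A => c * g A)%R.
  by move=> cg A; apply: continuousM; [exact: cst_continuous|exact: cg].
apply: cM; apply: continuous_big => [|i _]; first exact: mul_continuous.
exact: coord_continuous.
Qed.

Lemma SO_entry_le1 (A : 'M[R]_n) i j : SO A -> (`|A i j| <= 1)%R.
Proof.
move=> [AA _]; rewrite -(@ler_pXn2r _ 2)// ?nnegrE// expr1n.
have : (A *m A^T) i i = 1%R by rewrite AA mxE eqxx.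
rewrite mxE => <-; rewrite (bigD1 j)//= mxE real_normK ?num_real// expr2 lerDl.
by apply: sumr_ge0 => k _; rewrite mxE -expr2 sqr_ge0.
Qed.

(** A supremum of continuous functions of [A]. *)
Lemma lsc_Legendre_trmx (psi : 'cV[R]_n -> \bar R) (x : 'cV[R]_n) :
  (forall y, -oo < psi y) ->
  lower_semicontinuous (fun A : 'M[R]_n => Legendre psi (A^T *m x)%R).
Proof.
move=> psiNy A a /ereal_sup_gt[_ [y _ <-]]; have := psiNy y.
case E : (psi y) => [v| |] // _.
rewrite -EFinB lte_fin dotp_trmx => h.
exists [set B : 'M[R]_n | (a + v < dotp x (B *m y))%R].
  have hA : (a + v < dotp x (A *m y))%R by rewrite -ltrBrDr.
  exact: (@continuous_dotp_mulmx x y A _ (lt_nbhsr hA)).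
move=> B /= hB; apply: (@lt_le_trans _ _ ((dotp (B^T *m x)%R y)%:E - psi y)).
  by rewrite E -EFinB lte_fin dotp_trmx ltrBrDr.
by apply: ereal_sup_ubound; exists y.
Qed.

End matrix_borel.

(** * Averages over SO(n) *)

Section SO_average.
Context (R : realType) (n : nat) (mu : probability (mxborel R n) R).
Hypothesis muSO : mu (@SO R n) = 1.

Let SOm : set (mxborel R n) := @SO R n.
Let mSO : measurable SOm. Proof. exact: measurable_SO. Qed.

Notation grid N := {ffun 'I_n * 'I_n -> 'I_(2 * N).+1}.

(** The partition that discretises the integral over SO(n). Entries lie in
    [-1, 1], so [N * (A i j + 1)] has its integer part in [0, 2 * N]. *)
Definition grid_cell (N : nat) (g : grid N) : set (mxborel R n) :=
  [set A : 'M[R]_n | SO A /\ forall p : 'I_n * 'I_n,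
    ((g p)%:R <= N%:R * (A p.1 p.2 + 1) < (g p).+1%:R)%R].

Lemma measurable_entry i j :
  measurable_fun [set: mxborel R n] (fun A : mxborel R n => (A : 'M[R]_n) i j).
Proof. by apply: continuous_measurable_mx => A; exact: coord_continuous. Qed.

Lemma measurable_grid_cell N (g : grid N) : measurable (grid_cell g).
Proof.
rewrite (_ : grid_cell g = SOm `&` \bigcap_(p in [set: 'I_n * 'I_n])
    [set A : mxborel R n | (g p)%:R <=
      N%:R * ((A : 'M[R]_n) p.1 p.2 + 1) < (g p).+1%:R]%R); last first.
  apply/seteqP; split=> A [SA h]; split => // p; first by move=> _; exact: h.
  exact: (h p).
apply: measurableI => //; apply: fin_bigcap_measurable => // p _.
apply: measurable_setb.
have mp : measurable_fun [set: mxborel R n]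
    (fun A : mxborel R n => N%:R * ((A : 'M[R]_n) p.1 p.2 + 1))%R.
  apply: measurable_funM => //; apply: measurable_funD => //.
  exact: measurable_entry.
by apply: measurable_and; [exact: measurable_fun_ler|exact: measurable_fun_ltr].
Qed.

Lemma grid_cell_cover N (A : 'M[R]_n) : (0 < N)%N -> SO A ->
  exists g : grid N, grid_cell g A /\ forall g', grid_cell g' A -> g' = g.
Proof.
move=> N0 SA; have N0R : (0 < N%:R :> R)%R by rewrite ltr0n.
have A1 p : (0 <= A p.1 p.2 + 1 <= 2)%R.
  have := SO_entry_le1 p.1 p.2 SA; rewrite ler_norml => /andP[h1 h2].
  by apply/andP; split; lra.
have u0 p : (0 <= N%:R * (A p.1 p.2 + 1))%R.
  by rewrite mulr_ge0//; have /andP[] := A1 p.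
pose t p := Num.truncn (N%:R * (A p.1 p.2 + 1))%R.
have tN p : (t p < (2 * N).+1)%N.
  rewrite ltnS -(@ler_nat R) (le_trans (_ : _ <= N%:R * (A p.1 p.2 + 1)))%R//.
    by have /andP[] := truncn_itv (u0 p).
  by rewrite natrM mulrC ler_wpM2r//; have /andP[] := A1 p.
exists [ffun p => Ordinal (tN p)]; split.
  by split => // p; rewrite ffunE/=; exact: truncn_itv.
move=> g' [_ h]; apply/ffunP => p; rewrite ffunE; apply/val_inj => /=.
by rewrite /t; apply/esym/truncn_def; exact: h.
Qed.

Lemma grid_cell_close N (g : grid N) (A B : 'M[R]_n) i j : (0 < N)%N ->
  grid_cell g A -> grid_cell g B -> (`|A i j - B i j| <= N%:R^-1)%R.
Proof.
move=> N0 [_ /(_ (i, j)) hA] [_ /(_ (i, j)) hB]; move: hA hB => /=.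
have N0R : (0 < N%:R :> R)%R by rewrite ltr0n.
rewrite -natr1 => /andP[a1 a2] /andP[b1 b2].
rewrite -div1r ler_pdivlMr// -(gtr0_norm N0R) -normrM ler_norml.
by apply/andP; split; lra.
Qed.

Context (psi phi : 'cV[R]_n -> \bar R).
Hypothesis psiNy : forall x, -oo < psi x.
Hypothesis phiC : Conv_c phi.
Hypothesis phiE : forall x, Legendre phi x =
  \int[mu]_(A in @SO R n) Legendre psi (invmx (A : 'M[R]_n) *m x)%R.

(** The rotation [A] is replaced by a representative of its grid cell. The point
    [y] is the mean of [A z_A], where [z_A] depends on the cell of [A] only: by
    the definition of [phi] and biduality, [phi y] is at most the mean of the
    values [psi z_A]. *)
Lemma SO_below_averages (r : R) (k : nat) : (0 <= r)%R ->
  below_averages psi phi r k.+1%:R^-1%R.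
Proof.
move=> r0.
pose N := (Num.truncn (n%:R * r * k.+1%:R)%R).+1.
have N0 : (0 < N)%N by [].
have NR0 : (0 < N%:R :> R)%R by rewrite ltr0n.
have Nk : (n%:R * r / N%:R <= k.+1%:R^-1 :> R)%R.
  rewrite ler_pdivrMr// ler_pdivlMl// mulrC.
  exact: ltW (truncnS_gt _).
pose I : finType := grid N.
pose one (g : I) : mxborel R n -> R := \1_(grid_cell g).
pose E (f : mxborel R n -> R) := (\int[mu]_(A in SOm) f A)%R.
have b1 g : bounded_mfun SOm (one g).
  by apply: bounded_mfun_indic; exact: measurable_grid_cell.
have bA i j : bounded_mfun SOm (fun A : mxborel R n => (A : 'M[R]_n) i j).
  split; first exact: measurable_entry.
  by exists 1%R => A SA; exact: SO_entry_le1.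
have bint f : bounded_mfun SOm f -> mu.-integrable SOm (EFin \o f).
  exact: (bounded_mfun_integrable mu mSO).
have Ele f f' : bounded_mfun SOm f -> bounded_mfun SOm f' ->
    (forall A, SOm A -> f A <= f' A)%R -> (E f <= E f')%R.
  by move=> bf bf'; apply: le_Rintegral => //; exact: bint.
have EZ c f : bounded_mfun SOm f -> E (fun A => c * f A)%R = (c * E f)%R.
  by move=> bf; apply: RintegralZl => //; exact: bint.
have EB f f' : bounded_mfun SOm f -> bounded_mfun SOm f' ->
    E (fun A => f A - f' A)%R = (E f - E f')%R.
  by move=> bf bf'; apply: RintegralB => //; exact: bint.
have Esum (J : finType) (f : J -> mxborel R n -> R) :
    (forall j, bounded_mfun SOm (f j)) ->
    E (fun A => \sum_j f j A)%R = (\sum_j E (f j))%R.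
  by move=> bf; exact: (Rintegral_sum mu mSO).
pose w g := E (one g).
pose M (g : I) : 'M[R]_n :=
  (\matrix_(i, j) E (fun A => one g A * (A : 'M[R]_n) i j))%R.
have w0 g : (0 <= w g)%R.
  by apply: Rintegral_ge0 => A _; rewrite /one indicE; case: (_ \in _).
have sumone A (G : I -> R) : SOm A -> exists2 g, grid_cell g A &
    (\sum_g one g A * G g = G g)%R.
  move=> /(grid_cell_cover N0)[g [gA gu]]; exists g => //.
  rewrite (bigD1 g)//= big1 ?addr0.
    by rewrite /one indicE mem_set// mul1r.
  move=> g' g'g; rewrite /one indicE memNset ?mul0r// => /gu g'E.
  by rewrite g'E eqxx in g'g.
have w1 : (\sum_g w g = 1)%R.
  rewrite -Esum// -[RHS](_ : E (fun=> 1%R) = 1%R); last first.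
    by rewrite /E Rintegral_cst// mul1r [X in fine X]muSO.
  apply: eq_Rintegral => A; rewrite inE => SA.
  have [g _ <-] := sumone A (fun=> 1%R) SA.
  by apply: eq_bigr => g' _; rewrite mulr1.
(* Empty cells have weight 0 but still need a rotation; 1 serves. *)
have /choice[A hA] (g : I) : exists A : 'M[R]_n, SO A /\
    forall B, grid_cell g B -> grid_cell g A.
  have [[A gA]|h] := pselect (exists A, grid_cell g A).
    by exists A; split=> [|B _]; [case: gA|].
  exists 1%:M%R; split; last by move=> B gB; exfalso; apply: h; exists B.
  by split; [rewrite trmx1 mulmx1|exact: det1].
exists I, w, A; split => //.
  move=> g; have [[AA dA] _] := hA g; by rewrite dA normr1.
move=> z c zr psiz.
have zj g j : (`|z g j ord0| <= r)%R.
  exact: le_trans (coord_le_norm _ _) (zr g).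
have bM g i j : bounded_mfun SOm (fun B => one g B * (B : 'M[R]_n) i j)%R.
  exact: bounded_mfunM.
have M1 g i j : (`|M g i j| <= w g)%R.
  rewrite mxE; apply: (le_trans (le_normr_Rintegral mSO (bint _ (bM g i j)))).
  apply: Ele => //; first exact: bounded_mfun_norm.
  move=> B SB; rewrite normrM /one indicE; case: (_ \in _); last first.
    by rewrite normr0 mul0r.
  by rewrite normr1 mul1r; exact: SO_entry_le1.
(* Entries vary by at most 1 / N within a cell. *)
have MA g i j : (`|M g i j - w g * A g i j| <= w g * N%:R^-1)%R.
  rewrite [(w g * A g i j)%R]mulrC -EZ// mxE -EB//; last first.
    by apply: bounded_mfunM => //; exact: bounded_mfun_cst.
  have bd : bounded_mfun SOm
      (fun B => one g B * (B : 'M[R]_n) i j - A g i j * one g B)%R.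
    apply: bounded_mfunB => //; apply: bounded_mfunM => //.
    exact: bounded_mfun_cst.
  apply: (le_trans (le_normr_Rintegral mSO (bint _ bd))).
  rewrite mulrC -EZ//; apply: Ele.
  - exact: bounded_mfun_norm.
  - by apply: bounded_mfunM => //; exact: bounded_mfun_cst.
  move=> B SB; rewrite /one indicE; have [gB|gB] := boolP (B \in grid_cell g).
    rewrite mul1r !mulr1; apply: (grid_cell_close _ _ N0); last first.
      by rewrite inE in gB; exact: (hA g).2 gB.
    by rewrite inE in gB.
  by rewrite mul0r !mulr0 subrr normr0.
pose y := (\sum_g M g *m z g)%R.
exists y; split.
- apply/norm_leP; first by rewrite mulr_ge0.
  move=> i; rewrite /y summxE (le_trans (ler_norm_sum _ _ _))//.
  rewrite (_ : n%:R * r = \sum_g w g * (n%:R * r))%R; last first.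
    by rewrite -mulr_suml w1 mul1r.
  apply: ler_sum => g _.
  rewrite mxE (le_trans (ler_norm_sum _ _ _))//.
  apply: (@le_trans _ _ (\sum_(j < n) w g * r)%R); last first.
    by rewrite sumr_const card_ord -mulrnAr -[(r *+ n)%R]mulr_natl.
  by apply: ler_sum => j _; rewrite normrM ler_pM.
- apply: le_trans Nk; apply/norm_leP; first by rewrite divr_ge0// mulr_ge0.
  move=> i; rewrite /y -sumrB summxE (le_trans (ler_norm_sum _ _ _))//.
  rewrite (_ : n%:R * r / N%:R = \sum_g w g * (n%:R * r / N%:R))%R; last first.
    by rewrite -mulr_suml w1 mul1r.
  apply: ler_sum => g _.
  rewrite scalemxAl -mulmxBl mxE (le_trans (ler_norm_sum _ _ _))//.
  apply: (@le_trans _ _ (\sum_(j < n) w g * N%:R^-1 * r)%R); last first.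
    rewrite sumr_const card_ord -[leLHS]mulr_natl le_eqVlt.
    by apply/orP; left; apply/eqP; ring.
  apply: ler_sum => j _; rewrite normrM ler_pM//.
  by have := MA g i j; rewrite !mxE.
- rewrite leNgt; apply/negP => /(affine_minorant phiC)[x [b [hb]]].
  apply/negP; rewrite -leNgt.
  (* K is the step function that picks, on the cell of the rotation B, the term
     of the supremum defining Legendre psi (B^T *m x) at the point z of this
     cell. *)
  pose K1 (g : I) (B : mxborel R n) :=
    (\sum_i \sum_j (x i ord0 * z g j ord0) * (one g B * (B : 'M[R]_n) i j))%R.
  pose K (B : mxborel R n) := (\sum_g (K1 g B - c g * one g B))%R.
  have bK1' g i j : bounded_mfun SOm
      (fun B => (x i ord0 * z g j ord0) * (one g B * (B : 'M[R]_n) i j))%R.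
    by apply: bounded_mfunM => //; exact: bounded_mfun_cst.
  have bK1 g : bounded_mfun SOm (K1 g).
    by do 2 (apply: bounded_mfun_sum => ?).
  have bc g : bounded_mfun SOm (fun B => c g * one g B)%R.
    by apply: bounded_mfunM => //; exact: bounded_mfun_cst.
  have bK2 g : bounded_mfun SOm (fun B => K1 g B - c g * one g B)%R.
    exact: bounded_mfunB.
  have bK : bounded_mfun SOm K by exact: bounded_mfun_sum.
  have EK : E K = (dotp x y - \sum_g w g * c g)%R.
    rewrite Esum//; under eq_bigr do rewrite EB// EZ//.
    rewrite sumrB; congr (_ - _)%R; last by apply: eq_bigr => g _; rewrite mulrC.
    rewrite /dotp /y; under [RHS]eq_bigr do rewrite summxE mulr_sumr.
    rewrite exchange_big/=; apply: eq_bigr => g _.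
    rewrite Esum; last by move=> i; apply: bounded_mfun_sum.
    apply: eq_bigr => i _; rewrite Esum// mxE mulr_sumr.
    by apply: eq_bigr => j _; rewrite EZ// [M g i j]mxE; ring.
  have KE (B : 'M[R]_n) g : K1 g B = (one g B * dotp x (B *m z g))%R.
    rewrite /K1 /dotp mulr_sumr; apply: eq_bigr => i _; rewrite mxE !mulr_sumr.
    by apply: eq_bigr => j _; ring.
  have LE : (E K)%:E <= Legendre phi x.
    rewrite phiE (eq_integral (fun A : mxborel R n =>
      Legendre psi ((A : 'M[R]_n)^T *m x)%R)); last first.
      move=> B; rewrite inE => -[BB _]; congr (Legendre psi (_ *m x)%R).
      have [uB _] := mulmx1_unit BB.
      by rewrite -[LHS]mulmx1 -BB mulKmx.
    apply: Rintegral_le_integral => //.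
      apply: measurable_funTS; apply: lsc_measurable_mx.
      exact: lsc_Legendre_trmx.
    move=> B SB; have [g gB gE] := sumone B
      (fun g => dotp x ((B : 'M[R]_n) *m z g)%R - c g)%R SB.
    rewrite (_ : K B = dotp x ((B : 'M[R]_n) *m z g) - c g)%R; last first.
      rewrite -gE; apply: eq_bigr => g' _.
      by rewrite KE mulrBr [(_ * c g')%R]mulrC.
    by apply: ereal_sup_ubound; exists (z g) => //; rewrite psiz dotp_trmx.
  have : (E K)%:E <= b%:E.
    apply: (le_trans LE); apply: ge_ereal_sup => _ [u _ <-].
    have := hb u; case: (phi u) => [v| |] //.
      by rewrite -EFinB !lee_fin; lra.
    by rewrite leNye.
  by rewrite lee_fin EK; lra.
Qed.

End SO_average.

(** * Dimension one *)

Lemma lt_adde_split (R : realType) (u v : \bar R) (b : R) :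
  -oo < u -> -oo < v -> b%:E < u + v ->
  exists b1 b2 : R, [/\ b1%:E < u, b2%:E < v & (b <= b1 + b2)%R].
Proof.
case: u => [u| |] //; case: v => [v| |] // _ _.
- rewrite -EFinD lte_fin => h.
  by exists (u - (u + v - b) / 2)%R, (v - (u + v - b) / 2)%R; split;
    rewrite ?lte_fin; lra.
- move=> _; exists (u - 1)%R, (b - u + 1)%R; split; rewrite ?ltry ?lte_fin//; lra.
- move=> _; exists (b - v + 1)%R, (v - 1)%R; split; rewrite ?ltry ?lte_fin//; lra.
- move=> _; exists b, 0%R; split; rewrite ?ltry//; lra.
Qed.

Section infimal_convolution.
Context (R : realType) (n : nat) (psi1 psi2 : 'cV[R]_n -> \bar R) (m : R).
Hypothesis psi1m : forall x, m%:E <= psi1 x.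
Hypothesis psi2m : forall x, m%:E <= psi2 x.
Hypothesis lpsi1 : lower_semicontinuous psi1.
Hypothesis lpsi2 : lower_semicontinuous psi2.
Hypothesis cpsi2 : coercive psi2.

(** Coercivity confines the infimum to a compact set of [y], on which lower
    semicontinuity in [(x, y)] is uniform. *)
Lemma lsc_infconv : lower_semicontinuous (infconv psi1 psi2).
Proof.
have ltNy1 x : -oo < psi1 x by apply: lt_le_trans (psi1m x); rewrite ltNyr.
have ltNy2 x : -oo < psi2 x by apply: lt_le_trans (psi2m x); rewrite ltNyr.
move=> x a /ereal_between[b ab bx].
have bxy y : b%:E < psi1 (x - y)%R + psi2 y.
  by apply: (lt_le_trans bx); apply: ereal_inf_lbound; exists y.
have [rho hrho] := cpsi2 (b - m)%R.
have /compact_near_coveringP cK := @compact_norm_le R n rho.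
have Kb : \forall x' \near x, [set y : 'cV[R]_n | (`|y| <= rho)%R] `<=`
    (fun y => b%:E <= psi1 (x' - y)%R + psi2 y).
  apply: (cK _ (nbhs x) (fun x' y => b%:E <= psi1 (x' - y)%R + psi2 y)) => y _.
  have [b1 [b2 [hb1 hb2 bb]]] := lt_adde_split (ltNy1 _) (ltNy2 _) (bxy y).
  have [V1 V1x V1b] := lpsi1 hb1; have [e1 e10 e1V] := nbhs_normP V1x.
  have [V2 V2y V2b] := lpsi2 hb2.
  have e20 : (0 < e1 / 2)%R by rewrite divr_gt0.
  exists (V2 `&` [set y' | `|y' - y| < e1 / 2]%R,
          [set x' | `|x' - x| < e1 / 2]%R).
    by split; [apply: filterI => //|]; exact: (norm_nbhs e20).
  move=> [y' x'] [/= [V2y' y'y] x'x].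
  apply: (@le_trans _ _ (b1%:E + b2%:E)); first by rewrite -EFinD lee_fin.
  apply: leeD; apply/ltW; last exact: V2b.
  apply/V1b/e1V; rewrite (_ : _ - _ = (x' - x) - (y' - y))%R; last first.
    by apply/matrixP => i j; rewrite !mxE; ring.
  by rewrite (le_lt_trans (ler_normB _ _))// [ltRHS]splitr ltrD.
exists [set x' | [set y : 'cV[R]_n | (`|y| <= rho)%R] `<=`
    (fun y => b%:E <= psi1 (x' - y)%R + psi2 y)] => // x' Kx'.
apply: (@lt_le_trans _ _ b%:E); first by rewrite lte_fin.
apply: le_ereal_inf_tmp => _ [y _ <-]; have [yr|ry] := leP `|y|%R rho.
  exact: Kx'.
apply: (@le_trans _ _ (m%:E + (b - m)%:E)).
  by rewrite -EFinD lee_fin addrC subrK.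
by apply: leeD => //; apply/ltW/hrho; exact: lt_le_trans ry (norm_le_enorm y).
Qed.

Lemma infconv_ge x : (m + m)%:E <= infconv psi1 psi2 x.
Proof. by apply: le_ereal_inf_tmp => _ [y _ <-]; rewrite EFinD leeD. Qed.

End infimal_convolution.

(** In dimension one the mean is over the two matrices 1 and -1, and the defining
    infimal convolution gives the averaging inequality without any displacement. *)
Section dimension_one.
Context (R : realType) (psi phi : 'cV[R]_1 -> \bar R).
Hypothesis psiC : Conv_c psi.
Hypothesis phiE : forall x,
  phi x = (2^-1)%:E * infconv psi (fun y => psi (- y)%R) (2 *: x)%R.

Let half_lt (u : \bar R) (a : R) : a%:E < (2^-1)%:E * u -> (2 * a)%:E < u.
Proof. by rewrite muleC -lte_pdivrMr ?invr_gt0// invrK EFinM muleC. Qed.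

Lemma lsc_rot1 : lower_semicontinuous phi.
Proof.
have [psiNy _ _ lpsi cpsi] := psiC; have [m hm] := Conv_c_lbound psiC.
have linf : lower_semicontinuous (infconv psi (fun y => psi (- y)%R)).
  apply: (@lsc_infconv _ _ _ _ m) => //.
    move=> x a /lpsi[V /nbhs_normP[e e0 eV] Va].
    exists [set y | (`|y - x| < e)%R]; first exact: (norm_nbhs e0).
    by move=> y yx; apply/Va/eV; rewrite -opprD normrN.
  move=> M; have [rho h] := cpsi M; exists rho => x xr; apply: h.
  by rewrite /enorm -scaleN1r dotpZl dotpZr !mulN1r opprK.
move=> x a; rewrite phiE => /half_lt /linf[V /nbhs_normP[e e0 eV] Va].
have e20 : (0 < e / 2)%R by rewrite divr_gt0.
exists [set y | (`|y - x| < e / 2)%R]; first exact: (norm_nbhs e20).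
move=> y /= yx; rewrite phiE.
have : (2 * a)%:E < infconv psi (fun y => psi (- y)%R) (2 *: y)%R.
  apply/Va/eV; rewrite -scalerBr normrZ ger0_norm//.
  by rewrite mulrC -ltr_pdivlMr.
by rewrite muleC -lte_pdivrMr ?invr_gt0// invrK EFinM muleC.
Qed.

Lemma rot1_below_averages (r : R) (k : nat) : (0 <= r)%R ->
  below_averages psi phi r k.+1%:R^-1%R.
Proof.
move=> r0.
exists bool, (fun=> 2^-1)%R, (fun b => if b then 1%:M else (- 1)%:M)%R; split => //.
- by rewrite big_bool/=; lra.
- by case; rewrite ?det1 ?normr1// det_scalar1 normrN1.
move=> z c zr psiz.
exists (2^-1 *: (z true - z false))%R; split.
- rewrite mul1r normrZ ger0_norm ?invr_ge0// ler_pdivrMl//.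
  by rewrite (le_trans (ler_normB _ _))// mulrDl !mul1r lerD.
- rewrite big_bool/= mul1mx mul_scalar_mx scaleN1r -scalerDr subrr normr0.
  by rewrite invr_ge0.
- rewrite phiE scalerA divff// scale1r big_bool/= -mulrDr EFinM.
  rewrite lee_pmul2l// ?lte_fin ?invr_gt0// EFinD -!psiz.
  apply: ereal_inf_lbound; exists (- z false)%R => //.
  by rewrite !opprK subrK.
Qed.

End dimension_one.

(** * The inequality *)

Theorem theorem9p1 (R : realType) (n : nat) (hn : (1 <= n)%N)
    (mu : probability (mxborel R n) R) (hmu : is_haar_SO mu)
    (f frot : 'cV[R]_n -> R) (hf : LC_c f) (hfrot : is_hypo_rot mu f frot) :
  J f <= J frot.
Proof.
have [psi [phi [psiC -> + ->]]] := hfrot; have [muSO _] := hmu.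
have [psiNy _ _ lpsi _] := psiC; rewrite /is_epi_rot.
have [n1|_] := eqVneq n 1%N.
  subst n => phiE; have [m hm] := Conv_c_lbound psiC.
  apply: (@J_le_of_averages _ _ _ _ psiNy lpsi m).
  - move=> x; rewrite phiE (_ : m = 2^-1 * (m + m))%R; last by lra.
    by rewrite EFinM lee_pmul2l ?lte_fin ?invr_gt0//; exact: infconv_ge.
  - exact: (lsc_rot1 psiC phiE).
  - by move=> r k; exact: (rot1_below_averages phiE).
move=> [phiC phiE]; have [m hm] := Conv_c_lbound phiC.
have [_ _ _ lphi _] := phiC.
apply: (J_le_of_averages psiNy lpsi hm lphi) => r k.
exact: (SO_below_averages muSO psiNy phiC phiE).
Qed.
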